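(* Let $S>0$ and let $A$, $B$ and $M$ be positive numbers such that $B>A$. There exists a constant $\alpha_{\rm c}=\alpha_{\rm c}(M,A,B,S)<0$ such that $$\lambda_{a,c}<\lambda_0$$ for all $\alpha\in[\alpha_{\rm c},0)$, $|a|\le M$ and $c\in[A,B]$ such that $(a,c)\neq\left(0,\sqrt{\tfrac{S}{\sqrt3}}\right)$.
   Context: For a bounded Lipschitz domain $\Omega\subset\mathbb{R}^2$ and $\alpha\in\mathbb{R}$, the lowest Robin eigenvalue is $$\lambda_1^\alpha(\Omega)=\inf_{u\in H^1(\Omega),\,u\neq0}\frac{\int_\Omega|\nabla u|^2+\alpha\int_{\partial\Omega}|u|^2}{\int_\Omega|u|^2},$$ with the boundary integral understood in the sense of traces. For fixed $S>0$, $a\in\mathbb{R}$ and $c>0$, $\Omega_{a,c}$ denotes the (open) triangle with vertices $(-c,0)$, $(c,0)$ and $(a,S/c)$, which has area $S$. With $c_0:=\sqrt{S/\sqrt3}$, $\Omega_0:=\Omega_{0,c_0}$ is the equilateral triangle of area $S$. Write $\lambda_{a,c}:=\lambda_1^\alpha(\Omega_{a,c})$ and $\lambda_0:=\lambda_1^\alpha(\Omega_0)$ (both depend on $\alpha$). *)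

(* Defs.v *)
From HB Require Import structures.
From mathcomp Require Import all_boot all_order all_algebra.
From mathcomp Require Import all_classical all_reals all_analysis.
From mathcomp Require Import measurable_realfun.

Set Implicit Arguments.
Unset Strict Implicit.
Unset Printing Implicit Defensive.

Import Order.TTheory GRing.Theory Num.Theory.
Import numFieldNormedType.Exports.

Local Open Scope classical_set_scope.
Local Open Scope ring_scope.

(* The library norm on R * R is the sup norm, hence the Euclidean distance
   and the squared Euclidean norm are written out. *)
Definition eucl_dist (R : realType) (p q : R * R) : R :=
  Num.sqrt ((q.1 - p.1) ^+ 2 + (q.2 - p.2) ^+ 2).

Definition sqnorm (R : realType) (v : R * R) : R := v.1 ^+ 2 + v.2 ^+ 2.

Definition area (R : realType) :
    {measure set (measurableTypeR R * measurableTypeR R) -> \bar R} :=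
  (@lebesgue_measure R \x @lebesgue_measure R)%E.

Definition e1 (R : realType) : R * R := (1, 0).
Definition e2 (R : realType) : R * R := (0, 1).

(* C^oo on the plane: every iterated directional derivative exists and is
   continuous everywhere. *)
Definition iter_derive (R : realType) (s : seq (R * R)) (f : R * R -> R) :
    R * R -> R :=
  foldr (fun v g => 'D_v g) f s.

Definition smooth (R : realType) (f : R * R -> R) : Prop :=
  forall s : seq (R * R),
    continuous (iter_derive s f) /\
    forall p v, derivable (iter_derive s f) p v.

Definition grad (R : realType) (f : R * R -> R) (p : R * R) : R * R :=
  ('D_(e1 R) f p, 'D_(e2 R) f p).

Definition test_function (R : realType) (Omega : set (R * R))
    (phi : R * R -> R) : Prop :=
  smooth phi /\
  exists K : set (R * R),
    [/\ compact K, K `<=` Omega & forall p, ~ K p -> phi p = 0].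

Definition weak_derivative (R : realType) (Omega : set (R * R)) (v : R * R)
    (u w : R * R -> R) : Prop :=
  forall phi, test_function Omega phi ->
    \int[area R]_(p in Omega) (u p * 'D_v phi p) =
    - \int[area R]_(p in Omega) (w p * phi p).

Definition square_integrable (d : measure_display) (T : measurableType d)
    (R : realType) (mu : {measure set T -> \bar R}) (D : set T)
    (f : T -> R) : Prop :=
  measurable_fun D f /\ (\int[mu]_(x in D) ((f x) ^+ 2)%:E < +oo)%E.

(* [is_H1 Omega u Du]: (the restriction to Omega of) u belongs to H^1(Omega),
   with weak gradient Du. *)
Definition is_H1 (R : realType) (Omega : set (R * R)) (u : R * R -> R)
    (Du : R * R -> R * R) : Prop :=
  [/\ square_integrable (area R) Omega u,
      square_integrable (area R) Omega (fun p => (Du p).1),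
      square_integrable (area R) Omega (fun p => (Du p).2),
      weak_derivative Omega (e1 R) u (fun p => (Du p).1) &
      weak_derivative Omega (e2 R) u (fun p => (Du p).2)].

(* [is_trace Omega sigma u Du g], for u in H^1(Omega) with weak gradient Du:
   g is the trace of u in L^2(sigma), sigma being the arc-length measure on the
   boundary of Omega.  The trace operator is the continuous extension to
   H^1(Omega) of the restriction to the boundary of functions that are smooth
   up to the boundary. *)
Definition is_trace (R : realType) (Omega : set (R * R))
    (sigma : {measure set (measurableTypeR R * measurableTypeR R) -> \bar R}) (u : R * R -> R)
    (Du : R * R -> R * R) (g : R * R -> R) : Prop :=
  square_integrable sigma setT g /\
  exists v : nat -> R * R -> R,
    [/\ forall n, smooth (v n),
        (\int[area R]_(p in Omega) ((v n p - u p) ^+ 2)%:E)%E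
          @[n --> \oo] --> 0%E,
        (\int[area R]_(p in Omega) (sqnorm (grad (v n) p - Du p))%:E)%E
          @[n --> \oo] --> 0%E &
        (\int[sigma]_p ((v n p - g p) ^+ 2)%:E)%E @[n --> \oo] --> 0%E].

Definition rayleigh (R : realType) (Omega : set (R * R))
    (sigma : {measure set (measurableTypeR R * measurableTypeR R) -> \bar R}) (alpha : R) (u : R * R -> R)
    (Du : R * R -> R * R) (g : R * R -> R) : R :=
  (\int[area R]_(p in Omega) sqnorm (Du p) +
     alpha * \int[sigma]_p (g p) ^+ 2) /
  \int[area R]_(p in Omega) (u p) ^+ 2.

(* The infimum is taken in the extended reals, where it always exists. *)
Definition robin_eigenvalue (R : realType) (Omega : set (R * R))
    (sigma : {measure set (measurableTypeR R * measurableTypeR R) -> \bar R}) (alpha : R) : \bar R :=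
  ereal_inf [set l : \bar R | exists u Du g,
    [/\ is_H1 Omega u Du,
        ~ {ae area R, forall p, Omega p -> u p = 0},
        is_trace Omega sigma u Du g &
        l = (rayleigh Omega sigma alpha u Du g)%:E]].

Definition segment_param (R : realType) (p q : R * R) (t : measurableTypeR R) :
    measurableTypeR R * measurableTypeR R :=
  (p.1 + t * (q.1 - p.1), p.2 + t * (q.2 - p.2)).

Lemma measurable_segment_param (R : realType) (p q : R * R) :
  measurable_fun setT (segment_param p q).
Proof.
by apply/measurable_fun_pairP; split => /=;
  apply: measurable_funD => //; exact: measurable_funM.
Qed.

Section arc_length.
Context (R : realType).

Definition unit_interval_length :
    {measure set (measurableTypeR R) -> \bar R} :=
  mrestr (@lebesgue_measure R) (measurable_itv `[0, 1]).

(* Push-forward of the length on [0, 1] by the affine parametrization of the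
   segment; it has total mass 1. *)
Definition segment_unit_length (p q : R * R) :=
  pushforward unit_interval_length (segment_param p q).

Section segment_unit_length_measure.
Variables p q : R * R.
Let mparam := measurable_segment_param p q.

Let segment_unit_length0 : segment_unit_length p q set0 = 0%E.
Proof. exact: measure0. Qed.

Let segment_unit_length_ge0 A : (0 <= segment_unit_length p q A)%E.
Proof. exact: measure_ge0. Qed.

Let segment_unit_length_sigma_additive :
  semi_sigma_additive (segment_unit_length p q).
Proof. exact: measure_semi_sigma_additive. Qed.

HB.instance Definition _ := isMeasure.Build _ _ _ (segment_unit_length p q)
  segment_unit_length0 segment_unit_length_ge0
  segment_unit_length_sigma_additive.

End segment_unit_length_measure.

Lemma eucl_dist_ge0 (p q : R * R) : 0 <= eucl_dist p q.
Proof. exact: sqrtr_ge0. Qed.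

Definition segment_length (p q : R * R) :
    {measure set (measurableTypeR R * measurableTypeR R) -> \bar R} :=
  mscale (NngNum (eucl_dist_ge0 p q)) (segment_unit_length p q).

Definition triangle_boundary_length (p q r : R * R) :
    {measure set (measurableTypeR R * measurableTypeR R) -> \bar R} :=
  measure_add (segment_length p q)
    (measure_add (segment_length q r) (segment_length r p)).

End arc_length.

(* The open triangle with vertices p, q, r (assumed not collinear): the points
   whose barycentric coordinates are all positive. *)
Definition triangle (R : realType) (p q r : R * R) : set (R * R) :=
  [set x | exists s t w : R,
    [/\ 0 < s, 0 < t, 0 < w, s + t + w = 1 &
        x = s *: p + t *: q + w *: r]].

Definition triangle_robin_eigenvalue (R : realType) (alpha : R)
    (p q r : R * R) : \bar R :=
  robin_eigenvalue (triangle p q r) (triangle_boundary_length p q r) alpha.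

(* lambda_1^alpha(Omega_{a,c}) for the triangles of area S with base 2c. *)
Definition lambda1 (R : realType) (S alpha a c : R) : \bar R :=
  triangle_robin_eigenvalue alpha (- c, 0) (c, 0) (a, S / c).

(* Main.v *)
Require Import Defs.
From HB Require Import structures.
From mathcomp Require Import all_boot all_order all_algebra.
From mathcomp Require Import all_classical all_reals all_analysis.
From mathcomp Require Import measurable_realfun.
From mathcomp Require Import ring lra.

Set Implicit Arguments.
Unset Strict Implicit.
Unset Printing Implicit Defensive.

Import Order.TTheory GRing.Theory Num.Theory.
Import numFieldNormedType.Exports.

Local Open Scope classical_set_scope.
Local Open Scope ring_scope.

(** The proof is by transplantation.  Let T0 be the equilateral triangle and T
    another triangle of the family.  Three area-preserving affine maps send T
    onto T0, one for each cyclic matching of the vertices.  A function v on T0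
    with gradient energy E, boundary integral B of its square and squared L^2
    norm N therefore yields three trial functions on T, all of squared norm N.
    The average of their three Rayleigh quotients is (Q E + alpha p B) / N,
    where Q is the ratio of the sums of squared sides of T and T0, and p the
    ratio of their perimeters ([robin_le_average]): the sum over a rotation of
    order three makes the quadratic form of the gradient isotropic
    ([pulled_sqnorm_sum]) and gives every side of T0 the same weight.  It is the
    quotients that are averaged, so v may be arbitrary.  Compared with the
    quotient (E + alpha B) / N of v on T0, there is a loss (Q - 1) E and a gain
    - alpha (p - 1) B.

    The perimeter is least for the equilateral triangle, and Heron's formula
    with a quantitative inequality of arithmetic and geometric means gives
    Q - 1 <= 4 p (p - 1) ([isoperimetric_deficit]), so loss and gain carry
    comparable geometric factors, up to the bound on p on the given range of
    triangles.

    It remains to see that E is of second order in alpha.  Constants have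
    quotient alpha kappa with kappa the perimeter of T0 divided by its area.
    The divergence theorem for the fields x - (vertex) gives a trace inequality
    B <= kappa N + O(tau N + E / tau) for all tau > 0, whose leading constant
    is sharp ([green_triangle], [trace_bound]).  If the quotient of v is at most
    alpha kappa, the choice of tau proportional to - alpha yields
    E = O(alpha^2) N and B >= kappa N, so that for small - alpha the gain
    exceeds the loss by a fixed multiple of N ([rayleigh_gap]).  If the quotient
    of v exceeds alpha kappa, the constants on T do better by a fixed amount,
    since their quotient is alpha p kappa ([robin_le_perimeter]).  In both
    cases the gap does not depend on v, hence it survives in the infimum, and
    the trace inequality also shows that the infimum over T0 is finite
    ([robin_lt_equilateral]).

    All estimates are proved for smooth functions, where they reduce to
    one-variable calculus through Fubini's theorem, and pass to H^1 along the
    smooth approximations that define the trace ([admissible_approx]). *)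

(** * Area-preserving maps of the plane *)

(** Both sides are measures that agree on half-open intervals. *)
Lemma lebesgue_preimage_affine (R : realType) (k b : R)
    (X : set (measurableTypeR R)) : 0 < k -> measurable X ->
  (k%:E * lebesgue_measure
    ((fun x : measurableTypeR R => (k * x + b : measurableTypeR R)%R) @^-1` X) =
   lebesgue_measure X)%E.
Proof.
move=> k0 mX.
have mf : measurable_fun setT (fun x : measurableTypeR R => (k * x + b : measurableTypeR R)).
  by apply: measurable_funD => //; exact: measurable_funM.
pose f := fun x : measurableTypeR R => k * x + b : measurableTypeR R.
pose m := mscale (NngNum (ltW k0))
  (measure_function_pushforward__canonical__measure_function_Measure
    (@lebesgue_measure R) mf).
suff H : forall Y, measurable Y -> lebesgue_measure Y = m Y by rewrite (H _ mX).
apply: lebesgue_measure_unique => Y [[u v] _ <-] /=.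
rewrite /m /mscale /= /pushforward /=.
have -> : f @^-1` `]u, v]%classic = `](u - b) / k, (v - b) / k]%classic.
  apply/seteqP; split => x /=; rewrite !in_itv /= /f ltr_pdivrMr// ler_pdivlMr//;
    by rewrite [x * k]mulrC ltrBlDr lerBrDr.
rewrite !lebesgue_measure_itv /= !lte_fin ltr_pM2r ?invr_gt0// ltrD2r.
case: ifPn => _; last by rewrite mule0.
rewrite -!EFinB -EFinM; congr (_%:E).
by field; rewrite gt_eqF.
Qed.

Section continuous_measurable_plane.
Variable R : realType.
Notation plane := (measurableTypeR R * measurableTypeR R)%type.

(** The sigma-algebra of the plane is the product one, so that an open set is
    measurable because it is a countable union of boxes with rational centres. *)
Lemma open_measurable_plane (U : set (R * R)) :
  open U -> measurable (U : set plane).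
Proof.
move=> oU.
pose box (i : rat * rat * nat) : set plane :=
  ball (ratr i.1.1 : R) i.2.+1%:R^-1 `*` ball (ratr i.1.2 : R) i.2.+1%:R^-1.
have -> : (U : set plane) = \bigcup_(i in [set i | box i `<=` U]) box i.
  apply/seteqP; split => [p Up|p [i /= iU] /iU//].
  have /nbhs_ballP[e /= e0 eU] : nbhs p U by exact: open_nbhs_nbhs.
  have [n ne] : exists n, n.+1%:R^-1 < e / 2.
    have [n _ hn] := near_infty_natSinv_lt (PosNum (divr_gt0 e0 (ltr0n _ 2))).
    by exists n; exact: (hn n (leqnn n)).
  have n0 : 0 < n.+1%:R^-1 :> R by rewrite invr_gt0.
  have rat_near (d : R) (x : R) : 0 < d -> exists q : rat, ball (ratr q : R) d x.
    move=> d0; have /rat_in_itvoo[q] : x - d < x + d by lra.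
    rewrite in_itv /= => /andP[h1 h2]; exists q; rewrite /ball /= ltr_norml.
    by apply/andP; split; lra.
  have [q1 hq1] := rat_near _ p.1 n0; have [q2 hq2] := rat_near _ p.2 n0.
  exists (q1, q2, n) => //= z [/= z1 z2]; apply: eU; split => /=.
    exact: (ball_splitr (le_ball (ltW ne) hq1) (le_ball (ltW ne) z1)).
  exact: (ball_splitr (le_ball (ltW ne) hq2) (le_ball (ltW ne) z2)).
rewrite bigcup_mkcond; apply: countable_bigcupT_measurable => // i.
by case: ifP => // _; apply: measurableX; exact: measurable_ball.
Qed.

Lemma continuous_measurable_plane (f : R * R -> R) :
  continuous f -> measurable_fun setT (f : plane -> measurableTypeR R).
Proof.
move=> /continuousP cf; apply: (measurability _ (RGenOInfty.measurableE R)) => //=.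
move=> _ [_ [a ->] <-]; rewrite setTI; apply: open_measurable_plane.
by rewrite set_itvoy; exact/cf/open_gt.
Qed.

End continuous_measurable_plane.

Section area_preserving.
Variable R : realType.
Notation plane := (measurableTypeR R * measurableTypeR R)%type.

Definition area_preserving (T : R * R -> R * R) :=
  measurable_fun setT (T : plane -> plane) /\
  forall X : set plane, measurable X -> area R (T @^-1` X) = area R X.

Lemma area_preserving_comp T U :
  area_preserving T -> area_preserving U -> area_preserving (T \o U).
Proof.
move=> [mT aT] [mU aU]; split; first exact: (measurableT_comp mT mU).
move=> X mX; rewrite comp_preimage aU ?aT//.
by rewrite -[X in measurable X]setTI; exact: mT.
Qed.

(** By slicing: on each vertical line a vertical shear is a translation. *)
Lemma area_preserving_vshear (f : R -> R) : measurable_fun setT f ->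
  area_preserving (fun z => (z.1, z.2 + f z.1)).
Proof.
move=> mf; split.
  apply/measurable_fun_pairP; split; first exact: measurable_fst.
  have m2 : measurable_fun setT (fun z : plane => z.2 : R) by exact: measurable_snd.
  exact: (measurable_funD m2 (measurableT_comp mf measurable_fst)).
move=> X mX; rewrite /area /= /product_measure1; apply: eq_integral => x _ /=.
rewrite -(lebesgue_preimage_affine (f x) ltr01 (measurable_xsection x mX)) mul1e.
congr (lebesgue_measure _); apply/seteqP; split => y /=;
  by rewrite !xsectionE /= mul1r.
Qed.

Lemma area_preserving_hshear (f : R -> R) : measurable_fun setT f ->
  area_preserving (fun z => (z.1 + f z.2, z.2)).
Proof.
move=> mf.
have mT : measurable_fun setT (fun z : plane => (z.1 + f z.2, z.2) : plane).
  apply/measurable_fun_pairP; split; last exact: measurable_snd.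
  have m1 : measurable_fun setT (fun z : plane => z.1 : R) by exact: measurable_fst.
  exact: (measurable_funD m1 (measurableT_comp mf measurable_snd)).
split=> // X mX.
(* horizontal slices come with the iterated integral in the other order *)
have aE Y : measurable Y -> area R Y = (lebesgue_measure \x^ lebesgue_measure)%E Y.
  by move=> mY; apply: product_measure_unique => // A B mA mB; exact: product_measure2E.
rewrite !aE//; last by rewrite -[Y in measurable Y]setTI; exact: mT.
rewrite /= /product_measure2; apply: eq_integral => x _ /=.
rewrite -(lebesgue_preimage_affine (f x) ltr01 (measurable_ysection x mX)) mul1e.
congr (lebesgue_measure _); apply/seteqP; split => y /=;
  by rewrite !ysectionE /= mul1r.
Qed.

Definition affine_map (a b c d e f : R) (z : R * R) : R * R :=
  (a * z.1 + b * z.2 + e, c * z.1 + d * z.2 + f).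

(** A matrix of determinant 1 with a nonzero entry b is a product of three
    shears; if b = 0, one more shear makes it nonzero. *)
Lemma area_preserving_affine (a b c d e f : R) : a * d - b * c = 1 ->
  area_preserving (affine_map a b c d e f).
Proof.
have maff (k l : R) : measurable_fun setT (fun x : R => k * x + l).
  by apply: measurable_funD => //; exact: measurable_funM.
(* first and last factor: vertical shears, middle factor: a horizontal one *)
have shears (a' b' c' d' : R) : b' != 0 -> a' * d' - b' * c' = 1 ->
    area_preserving (affine_map a' b' c' d' e f).
  move=> b0 h.
  have -> : affine_map a' b' c' d' e f =
      (fun z => (z.1, z.2 + ((d' - 1) / b' * z.1 + (f - (d' - 1) / b' * e)))) \o
      (fun z => (z.1 + (b' * z.2 + e), z.2)) \o
      (fun z => (z.1, z.2 + ((a' - 1) / b' * z.1 + 0))).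
    apply/funext => z; rewrite /affine_map /=; congr pair; first by field.
    have -> : c' = (a' * d' - 1) / b' by rewrite -h; field.
    by field.
  apply: area_preserving_comp; last exact: (area_preserving_vshear (maff _ _)).
  apply: area_preserving_comp; last exact: (area_preserving_hshear (maff _ _)).
  exact: (area_preserving_vshear (maff _ _)).
move=> h; have [b0|] := eqVneq b 0; last by move=> ?; exact: shears.
have -> : affine_map a b c d e f =
    affine_map a (a + b) c (c + d) e f \o (fun z => (z.1 + (- 1 * z.2 + 0), z.2)).
  by apply/funext => z; rewrite /affine_map /=; congr pair; ring.
apply: area_preserving_comp; last exact: (area_preserving_hshear (maff _ _)).
apply: shears; last by rewrite -h; ring.
rewrite b0 addr0; apply/eqP => a0; move: h; rewrite a0 b0 !mul0r subr0.
by move/eqP; rewrite eq_sym oner_eq0.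
Qed.

Lemma integral_area_preserving T (D : set (R * R)) (f : R * R -> \bar R) :
    area_preserving T -> measurable (D : set plane) ->
    measurable_fun (D : set plane) f ->
  (\int[area R]_(z in D) f z = \int[area R]_(z in T @^-1` D) f (T z))%E.
Proof.
move=> [mT aT] mD mf.
have ge0 (g : R * R -> \bar R) : measurable_fun (D : set plane) g ->
    (forall z, 0 <= g z)%E ->
    (\int[area R]_(z in D) g z = \int[area R]_(z in T @^-1` D) g (T z))%E.
  move=> mg g0.
  rewrite -(ge0_integral_pushforward mT (area R) mD mg) => [|z _]; last exact: g0.
  by apply: eq_measure_integral => A mA _; rewrite /= /pushforward aT.
rewrite integralE (ge0 (f^\+)%E) ?(ge0 (f^\-)%E)//.
- rewrite [RHS]integralE; congr (_ - _)%E; apply: eq_integral => z _ /=;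
    by rewrite ?funeposE ?funenegE.
- exact: measurable_funeneg.
- exact: measurable_funepos.
Qed.

Lemma Rintegral_area_preserving T (D : set (R * R)) (f : R * R -> R) :
    area_preserving T -> measurable (D : set plane) ->
    measurable_fun (D : set plane) f ->
  \int[area R]_(z in D) f z = \int[area R]_(z in T @^-1` D) f (T z).
Proof.
move=> aT mD mf; rewrite /Rintegral (integral_area_preserving aT)//.
exact/measurable_EFinP.
Qed.

End area_preserving.

Section plane_integrability.
Variable R : realType.
Notation plane := (measurableTypeR R * measurableTypeR R)%type.

Definition square (L : R) : set (R * R) :=
  `[- L, L]%classic `*` `[- L, L]%classic.

Lemma measurable_square (L : R) : measurable (square L : set plane).
Proof. by apply: measurableX; exact: measurable_itv. Qed.

Lemma integrable_plane (L : R) (D : set (R * R)) (f : R * R -> R) :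
  measurable (D : set plane) -> D `<=` square L -> continuous f ->
  (area R).-integrable D (EFin \o f).
Proof.
move=> mD DL cf.
have mQ := measurable_square L.
apply: measurable_bounded_integrable => //.
- apply: (@le_lt_trans _ _ (area R (square L))).
    by apply: le_measure; rewrite ?inE.
  rewrite /area /= product_measure1E//= lebesgue_measure_itv /=.
  by case: ifP => _; rewrite ?mule0 ?ltry// -EFinB -EFinM ltry.
- exact: measurable_funTS (continuous_measurable_plane cf).
- have cK : compact (`[- L, L]%classic `*` `[- L, L]%classic : set (R * R)).
    by apply: compact_setX; exact: segment_compact.
  have : compact (f @` (`[- L, L]%classic `*` `[- L, L]%classic)).
    by apply: continuous_compact cK; exact: continuous_subspaceT.
  move=> /compact_bounded [M [Mr hM]]; exists M; split => // x Mx y Dy /=.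
  by apply: (hM x Mx); exists y => //; exact: DL.
Qed.

End plane_integrability.

(** * Directional derivatives of smooth functions *)

Section smooth_calculus.
Variable R : realType.
Implicit Types (f g : R * R -> R) (p v w : R * R).

Lemma smooth_continuous f : smooth f -> continuous f.
Proof. by move=> /(_ [::])[]. Qed.

Lemma smooth_derivable f p v : smooth f -> derivable f p v.
Proof. by move=> /(_ [::])[_ /(_ p v)]. Qed.

Lemma smooth_derive f v : smooth f -> smooth ('D_v f).
Proof.
move=> sf s; have := sf (rcons s v).
by rewrite /iter_derive foldr_rcons.
Qed.

Lemma smooth_cst (k : R) : smooth (cst k : R * R -> R).
Proof.
have [k' ->] : exists k' : R, k = k' by exists k.
move=> s; have [l ->] : exists l : R, iter_derive s (cst k' : R * R -> R) = cst l.
  elim: s => [|v s [l hl]]; first by exists k'.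
  exists 0; rewrite /iter_derive/= -/(iter_derive _ _) hl.
  by apply/funext => p; exact: derive_cst.
split; first exact: cst_continuous.
by move=> p v; exact: derivable_cst.
Qed.

Definition lin_map (a b c d : R) v : R * R := (a * v.1 + b * v.2, c * v.1 + d * v.2).

(** The difference quotient of f o T in direction v is that of f in the
    direction of the image of v, even before passing to the limit.  Hence
    smoothness is invariant under affine changes of variables. *)
Lemma derive_quotient_affine f (a b c d e k : R) p v :
  (fun h : R => h^-1 *: (((f \o affine_map a b c d e k) \o shift p) (h *: v) -
      (f \o affine_map a b c d e k) p)) =
  (fun h : R => h^-1 *: ((f \o shift (affine_map a b c d e k p))
      (h *: lin_map a b c d v) - f (affine_map a b c d e k p))).
Proof.
apply/funext => h; congr (_ *: (_ - _)) => /=; congr (f _).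
by rewrite /affine_map /lin_map /=; congr pair; rewrite /= /GRing.scale /=; ring.
Qed.

Lemma derive_affine f (a b c d e k : R) p v :
  'D_v (f \o affine_map a b c d e k) p =
  'D_(lin_map a b c d v) f (affine_map a b c d e k p).
Proof. by rewrite /derive /= derive_quotient_affine. Qed.

Lemma affine_map_continuous (a b c d e k : R) : continuous (affine_map a b c d e k).
Proof.
have C (l m n : R) : continuous (fun z : R * R => l * z.1 + m * z.2 + n).
  move=> p; apply: cvgD; last exact: cvg_cst.
  by apply: cvgD; apply: cvgM; try exact: cvg_cst; [exact: cvg_fst|exact: cvg_snd].
by move=> p; exact: (cvg_pair (C a b e p) (C c d k p)).
Qed.

Lemma smooth_affine f (a b c d e k : R) :
  smooth f -> smooth (f \o affine_map a b c d e k).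
Proof.
move=> sf s.
have -> : iter_derive s (f \o affine_map a b c d e k) =
    iter_derive (map (lin_map a b c d) s) f \o affine_map a b c d e k.
  by elim: s => //= v s ->; apply/funext => p; exact: derive_affine.
have [cD dD] := sf (map (lin_map a b c d) s); split.
  move=> p; apply: continuous_comp; [exact: affine_map_continuous|exact: cD].
by move=> p v; rewrite /derivable derive_quotient_affine; exact: dD.
Qed.

Lemma is_derive_hline f (y t : R) : derivable f (t, y) (e1 R) ->
  is_derive t 1 (fun x => f (x, y)) ('D_(e1 R) f (t, y)).
Proof.
have E : (fun h : R => h^-1 *: (((fun x => f (x, y)) \o shift t) (h *: 1) - f (t, y))) =
    (fun h : R => h^-1 *: ((f \o shift (t, y)) (h *: e1 R) - f (t, y))).
  apply/funext => h /=; congr (_ *: (f _ - _)).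
  by congr pair; rewrite /= /GRing.scale /=; ring.
by move=> df; apply: DeriveDef; rewrite /derivable /derive E.
Qed.

Lemma is_derive_vline f (x t : R) : derivable f (x, t) (e2 R) ->
  is_derive t 1 (fun y => f (x, y)) ('D_(e2 R) f (x, t)).
Proof.
have E : (fun h : R => h^-1 *: (((fun y => f (x, y)) \o shift t) (h *: 1) - f (x, t))) =
    (fun h : R => h^-1 *: ((f \o shift (x, t)) (h *: e2 R) - f (x, t))).
  apply/funext => h /=; congr (_ *: (f _ - _)).
  by congr pair; rewrite /= /GRing.scale /=; ring.
by move=> df; apply: DeriveDef; rewrite /derivable /derive E.
Qed.

Lemma MVT_any (g dg : R -> R) (x y : R) : (forall t : R, is_derive t (1 : R) g (dg t)) ->
  exists2 c, `|c - x| <= `|y - x| & g y - g x = dg c * (y - x).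
Proof.
move=> dgx.
have cg (u v : R) : {within `[u, v], continuous g}.
  apply: continuous_subspaceT => t.
  by apply/differentiable_continuous/derivable1_diffP; case: (dgx t).
have [xy|yx] := leP x y.
  have [c] := MVT_segment xy (fun t _ => dgx t) (cg x y).
  rewrite in_itv /= => /andP[xc cy] e; exists c => //.
  by rewrite !ger0_norm; lra.
have [c] := MVT_segment (ltW yx) (fun t _ => dgx t) (cg y x).
rewrite in_itv /= => /andP[yc cx] e; exists c; last by lra.
by rewrite !ler0_norm; lra.
Qed.

(** Continuity of the two partial derivatives makes the directional derivative
    linear in the direction: go from p to p + h v along the two axes and use the
    mean value theorem on each piece. *)
Lemma smooth_is_derive f p v : smooth f ->
  is_derive p v f (v.1 * 'D_(e1 R) f p + v.2 * 'D_(e2 R) f p).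
Proof.
move=> sf.
suff H : (fun h : R => h^-1 *: ((f \o shift p) (h *: v) - f p)) @ 0^' -->
    v.1 * 'D_(e1 R) f p + v.2 * 'D_(e2 R) f p.
  apply: DeriveDef; first by apply/cvg_ex; eexists; exact: H.
  exact: cvg_lim H.
apply/cvgrPdist_le => /= e e0.
pose K := `|v.1| + `|v.2| + 1.
have K0 : 0 < K by rewrite /K ltr_wpDl// addr_ge0.
have c1 := smooth_continuous (smooth_derive (e1 R) sf).
have c2 := smooth_continuous (smooth_derive (e2 R) sf).
have eK : 0 < e / K by rewrite divr_gt0.
have /cvgrPdist_le /(_ _ eK) /nbhs_ballP[d1 /= d10 hd1] := c1 p.
have /cvgrPdist_le /(_ _ eK) /nbhs_ballP[d2 /= d20 hd2] := c2 p.
pose d := Num.min d1 d2.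
have d0 : 0 < d by rewrite /d lt_min d10.
exists (d / K) => /=; first by rewrite divr_gt0.
move=> h /=; rewrite sub0r normrN => hd hn0.
have [x1 hx1 ex1] := MVT_any (p.1) (h * v.1 + p.1)
  (fun t => is_derive_hline (y := h * v.2 + p.2) (smooth_derivable sf)).
have [x2 hx2 ex2] := MVT_any (p.2) (h * v.2 + p.2)
  (fun t => is_derive_vline (x := p.1) (smooth_derivable sf)).
have hK (u : R) : `|u| <= K -> `|h * u| < d.
  move=> uK; rewrite normrM; apply: (@le_lt_trans _ _ (`|h| * K)).
    by rewrite ler_wpM2l.
  by rewrite -ltr_pdivlMr.
have v1K : `|v.1| <= K by rewrite /K -addrA lerDl addr_ge0.
have v2K : `|v.2| <= K by rewrite /K addrAC lerDr addr_ge0.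
have A1 : `|'D_(e1 R) f p - 'D_(e1 R) f (x1, h * v.2 + p.2)| <= e / K.
  apply: hd1; rewrite addrK in hx1; split => /=; rewrite /ball /= distrC.
    by apply: (le_lt_trans hx1); apply: (lt_le_trans (hK _ v1K)); rewrite /d ge_min lexx.
  by rewrite addrK; apply: (lt_le_trans (hK _ v2K)); rewrite /d ge_min lexx.
have A2 : `|'D_(e2 R) f p - 'D_(e2 R) f (p.1, x2)| <= e / K.
  apply: hd2; rewrite addrK in hx2; split => /=; rewrite /ball /= distrC.
    by rewrite subrr normr0.
  by apply: (le_lt_trans hx2); apply: (lt_le_trans (hK _ v2K)); rewrite /d ge_min lexx orbT.
have -> : f (h *: v + p) - f p = h * (v.1 * 'D_(e1 R) f (x1, h * v.2 + p.2) +
    v.2 * 'D_(e2 R) f (p.1, x2)).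
  have -> : h *: v + p = (h * v.1 + p.1, h * v.2 + p.2) by [].
  have -> : f p = f (p.1, p.2) by rewrite -surjective_pairing.
  rewrite addrK in ex1; rewrite addrK in ex2.
  by rewrite -(subrKA (f (p.1, h * v.2 + p.2))) ex1 ex2; ring.
rewrite /GRing.scale /= mulrA mulVf// mul1r opprD addrACA -!mulrBr.
apply: (le_trans (ler_normD _ _)); rewrite !normrM.
apply: (@le_trans _ _ (`|v.1| * (e / K) + `|v.2| * (e / K))).
  by apply: lerD; exact: ler_wpM2l.
rewrite -mulrDl mulrCA -[leRHS]mulr1 ler_wpM2l ?ltW// ltr_pdivrMr// mul1r.
by rewrite /K ltrDl.
Qed.

Lemma smooth_deriveE f p v : smooth f ->
  'D_v f p = v.1 * 'D_(e1 R) f p + v.2 * 'D_(e2 R) f p.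
Proof. by move=> sf; have /(@derive_val _ _ _ _ _ _) := smooth_is_derive p v sf. Qed.

Lemma derive_sqr f p v : smooth f ->
  is_derive p v (fun z => f z ^+ 2) (2 * f p * 'D_v f p).
Proof.
move=> sf; have /derivableP df : derivable f p v by exact: smooth_derivable.
rewrite (_ : (fun z => _) = f ^+ 2); last by apply/funext.
by apply: is_derive_eq; rewrite expr1 /GRing.scale /=.
Qed.

End smooth_calculus.

(** * Integration by parts against test functions *)

Section calculus1.
Variable R : realType.
Notation mu := (@lebesgue_measure R).

Lemma integral_derivative (F f : R -> R) (a b : R) : a < b ->
  (forall t : R, is_derive t (1 : R) F (f t)) -> continuous f ->
  (\int[mu]_(x in `[a, b]) (f x)%:E = (F b - F a)%:E)%E.
Proof.
move=> ab dF cf; rewrite (@continuous_FTC2 _ f F)//.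
- exact: continuous_subspaceT.
- have cF : continuous F.
    by move=> t; apply/differentiable_continuous/derivable1_diffP; case: (dF t).
  split; first by move=> x _; case: (dF x).
  + exact: cvg_at_right_filter (cF a).
  + exact: cvg_at_left_filter (cF b).
- by move=> x _; rewrite derive1E; case: (dF x).
Qed.

Lemma integral_derivative_oo (F f : R -> R) (a b : R) : a < b ->
  (forall t : R, is_derive t (1 : R) F (f t)) -> continuous f ->
  (\int[mu]_(x in `]a, b[) (f x)%:E = (F b - F a)%:E)%E.
Proof.
move=> ab dF cf.
have mf D : measurable_fun D (EFin \o f).
  by apply/measurable_EFinP; apply: measurable_funTS; exact: continuous_measurable_fun.
rewrite integral_itv_bndo_bndc; last exact: mf.
rewrite integral_itv_obnd_cbnd; last exact: mf.
exact: integral_derivative.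
Qed.

End calculus1.

Section lines.
Variable R : realType.

Lemma continuous_hline (f : R * R -> R) (y : R) :
  continuous f -> continuous (fun x => f (x, y)).
Proof.
move=> cf x; apply: (@continuous_comp _ _ _ (fun x : R => (x, y))); last exact: cf.
exact: (cvg_pair (@cvg_id _ (nbhs x)) (cvg_cst y)).
Qed.

Lemma continuous_vline (f : R * R -> R) (x : R) :
  continuous f -> continuous (fun y => f (x, y)).
Proof.
move=> cf y; apply: (@continuous_comp _ _ _ (fun y : R => (x, y))); last exact: cf.
exact: (cvg_pair (cvg_cst x) (@cvg_id _ (nbhs y))).
Qed.

End lines.

Section fubini_plane.
Variable R : realType.
Notation plane := (measurableTypeR R * measurableTypeR R)%type.
Notation mu := (@lebesgue_measure R).

Lemma fubini_ysection (L : R) (D : set (R * R)) (g : R * R -> R) :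
  measurable (D : set plane) -> D `<=` square L -> continuous g ->
  (\int[area R]_(z in D) (g z)%:E =
   \int[mu]_y \int[mu]_(x in [set x | D (x, y)]) (g (x, y))%:E)%E.
Proof.
move=> mD DL cg; rewrite integral_mkcond.
have ig : (area R).-integrable setT ((EFin \o g) \_ D).
  by apply/(integrable_mkcond _ mD); exact: integrable_plane DL cg.
rewrite -(integral21_prod_meas1 ig); apply: eq_integral => y _.
rewrite /fubini_G [RHS]integral_mkcond; apply: eq_integral => x _.
by rewrite !patchE; congr (if _ then _ else _); apply/idP/idP; rewrite !inE.
Qed.

Lemma fubini_xsection (L : R) (D : set (R * R)) (g : R * R -> R) :
  measurable (D : set plane) -> D `<=` square L -> continuous g ->
  (\int[area R]_(z in D) (g z)%:E =
   \int[mu]_x \int[mu]_(y in [set y | D (x, y)]) (g (x, y))%:E)%E.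
Proof.
move=> mD DL cg; rewrite integral_mkcond.
have ig : (area R).-integrable setT ((EFin \o g) \_ D).
  by apply/(integrable_mkcond _ mD); exact: integrable_plane DL cg.
rewrite -(integral12_prod_meas1 ig); apply: eq_integral => y _.
rewrite /fubini_F [RHS]integral_mkcond; apply: eq_integral => x _.
by rewrite !patchE; congr (if _ then _ else _); apply/idP/idP; rewrite !inE.
Qed.

End fubini_plane.

Section weak_derivatives.
Variable R : realType.
Notation plane := (measurableTypeR R * measurableTypeR R)%type.
Notation mu := (@lebesgue_measure R).
Implicit Types f v phi : R * R -> R.

(** Off its compact support, phi vanishes on a whole neighbourhood. *)
Lemma derive_support (K : set (R * R)) phi p w : compact K ->
  (forall q, ~ K q -> phi q = 0) -> ~ K p -> 'D_w phi p = 0.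
Proof.
move=> cK phi0 nKp.
have oK : open (~` K) by exact: closed_openC (compact_closed (@norm_hausdorff _ _) cK).
have nK : nbhs p (~` K) by apply: open_nbhs_nbhs.
apply: lim_near_cst => //.
have c0 : (fun h : R => h *: w + p) @ (0 : R) --> p.
  rewrite -[X in _ --> X](add0r p) -[X in _ --> (X + _)](scale0r w).
  by apply: cvgD; last exact: cvg_cst; exact: cvgZr_tmp.
have c0K : \forall h \near (0 : R), ~ K (h *: w + p) by exact: (c0 _ nK).
near=> h; have hK : ~ K (h *: w + p) by near: h; exact: nbhs_dnbhs c0K.
rewrite /=; rewrite (phi0 _ nKp) (phi0 _ hK) subrr scaler0.
Unshelve. all: by end_near.
Qed.

Lemma integral_e1_square (L : R) f : 0 < L ->
  (forall p, derivable f p (e1 R)) -> continuous ('D_(e1 R) f) ->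
  (forall y, f (L, y) = 0) -> (forall y, f (- L, y) = 0) ->
  \int[area R]_(z in square L) ('D_(e1 R) f z) = 0.
Proof.
move=> L0 df cf fL fNL; rewrite /Rintegral.
rewrite (@fubini_ysection _ L)//; last exact: measurable_square.
rewrite integral0_eq// => y _.
  have [yL|yL] := boolP (y \in `[- L, L]); last first.
    by rewrite (_ : [set _ | _] = set0) ?integral_set0//; apply/seteqP; split => x //= -[_] /=; rewrite (negbTE yL).
  rewrite (_ : [set _ | _] = `[- L, L]%classic); last first.
    by apply/seteqP; split => x /=; [case|move=> ?; split].
  transitivity (f (L, y) - f (- L, y))%:E; last by rewrite fL fNL subrr.
  apply: (@integral_derivative _ (fun x => f (x, y))).
  - by rewrite gtrN.
  - by move=> t; apply: is_derive_hline; exact: df.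
  - exact: (continuous_hline (y := y) cf).
Qed.

Lemma integral_e2_square (L : R) f : 0 < L ->
  (forall p, derivable f p (e2 R)) -> continuous ('D_(e2 R) f) ->
  (forall x, f (x, L) = 0) -> (forall x, f (x, - L) = 0) ->
  \int[area R]_(z in square L) ('D_(e2 R) f z) = 0.
Proof.
move=> L0 df cf fL fNL; rewrite /Rintegral.
rewrite (@fubini_xsection _ L)//; last exact: measurable_square.
rewrite integral0_eq// => x _.
  have [xL|xL] := boolP (x \in `[- L, L]); last first.
    by rewrite (_ : [set _ | _] = set0) ?integral_set0//; apply/seteqP; split => y //= -[] /=; rewrite (negbTE xL).
  rewrite (_ : [set _ | _] = `[- L, L]%classic); last first.
    by apply/seteqP; split => y /=; [case|move=> ?; split].
  transitivity (f (x, L) - f (x, - L))%:E; last by rewrite fL fNL subrr.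
  apply: (@integral_derivative _ (fun y => f (x, y))).
  - by rewrite gtrN.
  - by move=> t; apply: is_derive_vline; exact: df.
  - exact: (continuous_vline (x := x) cf).
Qed.

Lemma Rintegral_support (K D D' : set (R * R)) (g : R * R -> R) :
  (forall p, ~ K p -> g p = 0) -> K `<=` D -> K `<=` D' ->
  \int[area R]_(z in D) g z = \int[area R]_(z in D') g z.
Proof.
move=> g0 KD KD'; rewrite Rintegral_mkcond [RHS]Rintegral_mkcond.
have E B : K `<=` B -> g \_ B = g.
  move=> KB; apply/funext => p; rewrite patchE; case: ifPn => //.
  by rewrite notin_setE => nB; rewrite g0// => /KB.
by rewrite !E.
Qed.

Lemma le_square (L L' : R) : L <= L' -> square L `<=` square L'.
Proof.
move=> LL p [] /=; rewrite !in_itv /= => /andP[h1 h2] /andP[h3 h4].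
by split => /=; rewrite ?in_itv /=; apply/andP; split; lra.
Qed.

(** The classical derivative is a weak one: v phi has compact support, so the
    integral of its derivative over a large square vanishes line by line. *)
Lemma smooth_weak_derivative (L : R) (D : set (R * R)) v w :
  measurable (D : set plane) -> D `<=` square L -> smooth v ->
  w = e1 R \/ w = e2 R -> weak_derivative D w v ('D_w v).
Proof.
move=> mD DL sv ew phi [sphi [K [cK KD phi0]]].
pose psi (z : R * R) : R := v z * phi z.
have dpsi (u p : R * R) : is_derive p u psi (v p * 'D_u phi p + phi p * 'D_u v p).
  have /derivableP d1 : derivable v p u by exact: smooth_derivable.
  have /derivableP d2 : derivable phi p u by exact: smooth_derivable.
  exact: (is_deriveM d1 d2).
have dpsiE (u p : R * R) : 'D_u psi p = v p * 'D_u phi p + phi p * 'D_u v p.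
  by have dp := dpsi u p; rewrite derive_val.
have cv := smooth_continuous sv.
have cphi := smooth_continuous sphi.
have cD (u : R * R) (f : R * R -> R) : smooth f -> continuous ('D_u f).
  by move=> sf; exact/smooth_continuous/smooth_derive.
have cvD (u : R * R) : continuous (fun p : R * R => v p * 'D_u phi p).
  by move=> p; apply: cvgM; [exact: cv|exact: cD].
have cDv (u : R * R) : continuous (fun p : R * R => 'D_u v p * phi p).
  by move=> p; apply: cvgM; [exact: cD|exact: cphi].
have cDpsi (u : R * R) : continuous ('D_u psi).
  rewrite (_ : 'D_u psi = fun p => v p * 'D_u phi p + phi p * 'D_u v p).
    move=> p; apply: cvgD; first exact: cvD.
    by apply: cvgM; [exact: cphi|exact: cD].
  exact/funext/(dpsiE u).
have Dpsi0 (p : R * R) : ~ K p -> 'D_w psi p = 0.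
  by move=> nKp; rewrite dpsiE phi0// (derive_support w cK phi0 nKp) mulr0 mul0r addr0.
(* one unit larger, so that the support stays away from the sides *)
pose L' := `|L| + 1.
have LL' : L < L' by rewrite /L'; have := ler_norm L; lra.
have L'0 : 0 < L' by rewrite /L' ltr_wpDl.
have nK x y : K (x, y) -> - L' < x < L' /\ - L' < y < L'.
  move=> /KD /DL [] /=; rewrite !in_itv /= => /andP[h1 h2] /andP[h3 h4].
  by split; apply/andP; split; lra.
have psi0 p : ~ K p -> psi p = 0 by move=> h; rewrite /psi phi0// mulr0.
have I0 : \int[area R]_(z in D) 'D_w psi z = 0.
  rewrite (@Rintegral_support K D (square L'))//; last first.
    by move=> p /KD /DL; exact: (le_square (ltW LL')).
  case: ew => ->; [apply: integral_e1_square|apply: integral_e2_square] => //.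
  - by move=> y; apply: psi0 => /nK[]; rewrite ltxx andbF.
  - by move=> y; apply: psi0 => /nK[]; rewrite ltxx.
  - by move=> y; apply: psi0 => /nK[_]; rewrite ltxx andbF.
  - by move=> y; apply: psi0 => /nK[_]; rewrite ltxx.
apply/eqP; rewrite -subr_eq0 opprK; apply/eqP; rewrite -I0 -RintegralD//.
- by apply: eq_Rintegral => z _; rewrite dpsiE [phi z * _]mulrC.
- exact: integrable_plane DL _.
- exact: integrable_plane DL _.
Qed.

End weak_derivatives.

(** * The divergence theorem on a right triangle *)

Section green_reference.
Variable R : realType.
Notation plane := (measurableTypeR R * measurableTypeR R)%type.
Notation mu := (@lebesgue_measure R).

Lemma measurable_pos_set (l : R * R -> R) : continuous l ->
  measurable ([set z | 0 < l z] : set plane).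
Proof.
move=> cl; apply: open_measurable_plane.
by have := (@continuousP _ _ l).1 cl [set x | 0 < x] (@open_gt _ 0).
Qed.

(** The interior of the triangle (0,0), (s,0), (s,s); both families of slices
    parallel to the axes are intervals with explicit ends. *)
Definition ref_triangle (s : R) : set (R * R) :=
  [set z | [/\ 0 < z.2, 0 < z.1 - z.2 & 0 < s - z.1]].

Lemma measurable_ref_triangle s : measurable (ref_triangle s : set plane).
Proof.
have -> : ref_triangle s = [set z | 0 < z.2] `&` [set z | 0 < z.1 - z.2] `&` [set z | 0 < s - z.1].
  by apply/seteqP; split => z /=; [case|case => -[]].
have c1 : continuous (fst : R * R -> R) by move=> z; exact: cvg_fst.
have c2 : continuous (snd : R * R -> R) by move=> z; exact: cvg_snd.
apply: measurableI; first apply: measurableI; apply: measurable_pos_set => //.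
- by move=> z; apply: cvgB; [exact: c1|exact: c2].
- by move=> z; apply: cvgB; [exact: cvg_cst|exact: c1].
Qed.

Lemma ref_triangle_sub_square s : ref_triangle s `<=` square s.
Proof. by move=> z [/= h1 h2 h3]; split; rewrite /= in_itv /=; apply/andP; split; lra. Qed.

Lemma Rintegral_itv_oo (f : R -> R) (a b : R) : measurable_fun setT f ->
  \int[mu]_(x in `]a, b[) f x = \int[mu]_(x in `[a, b]) f x.
Proof.
move=> mf; rewrite /Rintegral [in RHS]integral_itv_bndoo//.
by apply/measurable_EFinP; exact: measurable_funTS.
Qed.

Lemma integrable_itv_oo (f : R -> R) (a b : R) : continuous f ->
  mu.-integrable `]a, b[ (EFin \o f).
Proof.
move=> cf; have : mu.-integrable `[a, b] (EFin \o f).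
  by apply: continuous_compact_integrable; [exact: segment_compact|exact: continuous_subspaceT].
by apply: integrableS => //; exact: subset_itv_oo_cc.
Qed.

Variables (s : R) (w : R * R -> R).
Hypotheses (cw : continuous w).
Hypotheses (dw1 : forall p, derivable w p (e1 R)) (dw2 : forall p, derivable w p (e2 R)).
Hypotheses (cw1 : continuous ('D_(e1 R) w)) (cw2 : continuous ('D_(e2 R) w)).

Let c1 : continuous (fst : R * R -> R). Proof. by move=> z; exact: cvg_fst. Qed.
Let c2 : continuous (snd : R * R -> R). Proof. by move=> z; exact: cvg_snd. Qed.
Let cx : continuous (fun z : R * R => w z + z.1 * 'D_(e1 R) w z).
Proof. by move=> z; apply: cvgD; [exact: cw|apply: cvgM; [exact: c1|exact: cw1]]. Qed.
Let cy : continuous (fun z : R * R => w z + z.2 * 'D_(e2 R) w z).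
Proof. by move=> z; apply: cvgD; [exact: cw|apply: cvgM; [exact: c2|exact: cw2]]. Qed.
Let cdiag : continuous (fun x : R => x * w (x, x)).
Proof.
move=> x; apply: cvgM; first exact: cvg_id.
apply: (@continuous_comp _ _ _ (fun x : R => (x, x))); last exact: cw.
exact: (cvg_pair (@cvg_id _ (nbhs x)) (@cvg_id _ (nbhs x))).
Qed.

Lemma ref_triangle_x :
  \int[area R]_(z in ref_triangle s) (w z + z.1 * 'D_(e1 R) w z) =
  \int[mu]_(y in `]0, s[) (s * w (s, y) - y * w (y, y)).
Proof.
congr fine; rewrite (fubini_ysection (measurable_ref_triangle s) (@ref_triangle_sub_square s) cx).
rewrite [RHS]integral_mkcond; apply: eq_integral => y _; rewrite patchE.
have [|ys] := boolP (y \in (`]0, s[%classic : set R)); last first.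
  rewrite (_ : [set _ | _] = set0) ?integral_set0//; apply/seteqP; split => x //= -[/= h1 h2 h3].
  by move: ys; rewrite notin_setE /= in_itv /= => h; apply: h; apply/andP; split; lra.
rewrite inE /= in_itv /= => /andP[y0 ys].
rewrite (_ : [set _ | _] = `]y, s[%classic); last first.
  apply/seteqP; split => x /=; rewrite in_itv /=.
    by move=> -[/= h1 h2 h3]; apply/andP; split; lra.
  by move=> /andP[h1 h2]; split => /=; lra.
apply: (@integral_derivative_oo _ (fun x => x * w (x, y)) (fun x => w (x, y) + x * 'D_(e1 R) w (x, y))) => //.
  move=> t; have dt := is_derive_hline (@dw1 (t, y : R)).
  apply: (is_derive_eq (is_deriveM (is_derive_id t (1 : R)) dt)).
  by rewrite /GRing.scale /=; ring.
exact: (continuous_hline (y := y) cx).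
Qed.

Lemma ref_triangle_y :
  \int[area R]_(z in ref_triangle s) (w z + z.2 * 'D_(e2 R) w z) =
  \int[mu]_(x in `]0, s[) (x * w (x, x)).
Proof.
congr fine; rewrite (fubini_xsection (measurable_ref_triangle s) (@ref_triangle_sub_square s) cy).
rewrite [RHS]integral_mkcond; apply: eq_integral => x _; rewrite patchE.
have [|xs] := boolP (x \in (`]0, s[%classic : set R)); last first.
  rewrite (_ : [set _ | _] = set0) ?integral_set0//; apply/seteqP; split => y //= -[/= h1 h2 h3].
  by move: xs; rewrite notin_setE /= in_itv /= => h; apply: h; apply/andP; split; lra.
rewrite inE /= in_itv /= => /andP[x0 xs].
rewrite (_ : [set _ | _] = `]0, x[%classic); last first.
  apply/seteqP; split => y /=; rewrite in_itv /=.
    by move=> -[/= h1 h2 h3]; apply/andP; split; lra.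
  by move=> /andP[h1 h2]; split => /=; lra.
rewrite -[x * w _]subr0 -[X in _ - X](mul0r (w (x, 0))).
apply: (@integral_derivative_oo _ (fun y => y * w (x, y)) (fun y => w (x, y) + y * 'D_(e2 R) w (x, y))) => //.
  move=> t; have dt := is_derive_vline (@dw2 (x : R, t)).
  apply: (is_derive_eq (is_deriveM (is_derive_id t (1 : R)) dt)).
  by rewrite /GRing.scale /=; ring.
exact: (continuous_vline (x := x) cy).
Qed.

(** The integrand is the divergence of the field z w(z).  This field is tangent
    to the two sides through the origin: slicing in the two directions produces
    opposite diagonal terms, and only the side x = s contributes. *)
Lemma green_ref_triangle :
  \int[area R]_(z in ref_triangle s)
    (2 * w z + (z.1 * 'D_(e1 R) w z + z.2 * 'D_(e2 R) w z)) =
  s * \int[mu]_(y in `[0, s]) w (s, y).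
Proof.
have cws : continuous (fun y : R => w (s, y)) by exact: continuous_vline.
transitivity (\int[mu]_(y in `]0, s[) (s * w (s, y) - y * w (y, y)) +
    \int[mu]_(x in `]0, s[) (x * w (x, x))).
  rewrite -ref_triangle_x -ref_triangle_y -RintegralD//.
  - by apply: eq_Rintegral => z _; ring.
  - exact: measurable_ref_triangle.
  - exact: integrable_plane (measurable_ref_triangle s) (@ref_triangle_sub_square s) cx.
  - exact: integrable_plane (measurable_ref_triangle s) (@ref_triangle_sub_square s) cy.
have csw : continuous (fun y : R => s * w (s, y)).
  by move=> y; apply: cvgM; [exact: cvg_cst|exact: cws].
rewrite -RintegralD//.
- under eq_Rintegral do rewrite subrK.
  rewrite Rintegral_itv_oo; last exact: continuous_measurable_fun.
  rewrite RintegralZl//.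
  by apply: continuous_compact_integrable; [exact: segment_compact|exact: continuous_subspaceT].
- apply: integrable_itv_oo => y; apply: cvgB; [exact: csw|exact: cdiag].
- exact: integrable_itv_oo.
Qed.

End green_reference.

Lemma Rintegral_scale (R : realType) (s : R) (f : R -> R) : 0 < s ->
  continuous f -> (forall x, 0 <= f x) ->
  \int[lebesgue_measure]_(y in `[0, s]) f y =
  s * \int[lebesgue_measure]_(t in `[0, 1]) f (s * t).
Proof.
move=> s0 cf f0; rewrite /Rintegral.
have mphi : measurable_fun setT (fun x : measurableTypeR R => (s * x + 0 : measurableTypeR R)).
  by apply: measurable_funD => //; exact: measurable_funM.
have mf D : measurable_fun D (EFin \o f).
  by apply/measurable_EFinP; apply: measurable_funTS; exact: continuous_measurable_fun.
pose m := mscale (NngNum (ltW s0))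
  (measure_function_pushforward__canonical__measure_function_Measure
    (@lebesgue_measure R) mphi).
have f0E : forall x, (`[0, s]%classic : set R) x -> (0 <= (EFin \o f) x)%E.
  by move=> x _; rewrite lee_fin.
have -> : (\int[lebesgue_measure]_(y in `[0%R, s]) (f y)%:E =
    s%:E * \int[lebesgue_measure]_(t in `[0%R, 1%R]) (f (s * t))%:E)%E.
  rewrite (eq_measure_integral m); last first.
    by move=> X mX _; apply: esym; exact: (lebesgue_preimage_affine 0 s0 mX).
  apply: (eq_trans (ge0_integral_mscale
    (measure_function_pushforward__canonical__measure_function_Measure
      (@lebesgue_measure R) mphi)
    (measurable_itv `[0%R, s]) (NngNum (ltW s0)) (mf _) f0E)).
  congr (_ * _)%E.
  apply: (eq_trans (ge0_integral_pushforward mphi _ (measurable_itv `[0%R, s]) (mf _) _)).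
    by move=> x _; rewrite lee_fin.
  rewrite (_ : _ @^-1` _ = `[0, 1]%classic).
    by apply: eq_integral => x _ /=; rewrite addr0.
  apply/funext => x; rewrite /= !in_itv /= addr0 pmulr_rge0//.
  by rewrite -[X in s * x <= X]mulr1 ler_pM2l.
rewrite fineM//; apply: integrable_fin_num => //.
apply: continuous_compact_integrable; first exact: segment_compact.
apply: continuous_subspaceT => x; apply: continuous_comp; last exact: cf.
by apply: cvgM; [exact: cvg_cst|exact: cvg_id].
Qed.

(** * Triangles up to area-preserving affine maps *)

Section triangles.
Variable R : realType.
Notation plane := (measurableTypeR R * measurableTypeR R)%type.
Implicit Types p q r z : R * R.

(** Twice the signed area of the triangle p q r. *)
Definition det3 p q r : R :=
  (q.1 - p.1) * (r.2 - p.2) - (q.2 - p.2) * (r.1 - p.1).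

Lemma affine_map_comb (a b c d e f s t w : R) p q r : s + t + w = 1 ->
  affine_map a b c d e f (s *: p + t *: q + w *: r) =
  s *: affine_map a b c d e f p + t *: affine_map a b c d e f q +
  w *: affine_map a b c d e f r.
Proof.
move=> h; have -> : s = 1 - t - w by lra.
by rewrite /affine_map; congr pair; rewrite /= /GRing.scale /=; ring.
Qed.

Lemma affine_map_inj (a b c d e f : R) : a * d - b * c = 1 ->
  injective (affine_map a b c d e f).
Proof.
move=> h z z' [h1 h2].
have e1 : z.1 - z'.1 = (a * d - b * c) * (z.1 - z'.1) by rewrite h mul1r.
have e2 : z.2 - z'.2 = (a * d - b * c) * (z.2 - z'.2) by rewrite h mul1r.
have {}h1 : a * (z.1 - z'.1) + b * (z.2 - z'.2) = 0 by lra.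
have {}h2 : c * (z.1 - z'.1) + d * (z.2 - z'.2) = 0 by lra.
have f1 : z.1 - z'.1 = 0.
  rewrite e1; transitivity (d * (a * (z.1 - z'.1) + b * (z.2 - z'.2)) -
    b * (c * (z.1 - z'.1) + d * (z.2 - z'.2))); first by ring.
  by rewrite h1 h2 !mulr0 subrr.
have f2 : z.2 - z'.2 = 0.
  rewrite e2; transitivity (a * (c * (z.1 - z'.1) + d * (z.2 - z'.2)) -
    c * (a * (z.1 - z'.1) + b * (z.2 - z'.2))); first by ring.
  by rewrite h1 h2 !mulr0 subrr.
rewrite [z]surjective_pairing [z']surjective_pairing; congr pair; lra.
Qed.

Lemma preimage_triangle (a b c d e f : R) p q r : a * d - b * c = 1 ->
  affine_map a b c d e f @^-1`
    triangle (affine_map a b c d e f p) (affine_map a b c d e f q) (affine_map a b c d e f r) =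
  triangle p q r.
Proof.
move=> h; apply/seteqP; split => z /= [s [t [w [s0 t0 w0 e1 ez]]]]; exists s, t, w; split => //.
  by move: ez; rewrite -affine_map_comb// => /(affine_map_inj h).
by rewrite ez affine_map_comb.
Qed.

(** The coefficients are explicit because the gradient of a transplanted function
    is computed from them. *)
Lemma affine_between p q r p' q' r' : det3 p q r != 0 ->
    det3 p q r = det3 p' q' r' ->
  exists a b c d e f : R, [/\ a * d - b * c = 1,
    affine_map a b c d e f p = p', affine_map a b c d e f q = q',
    affine_map a b c d e f r = r' &
    [/\ a = ((r.2 - p.2) * (q'.1 - p'.1) - (q.2 - p.2) * (r'.1 - p'.1)) / det3 p q r,
        b = ((q.1 - p.1) * (r'.1 - p'.1) - (r.1 - p.1) * (q'.1 - p'.1)) / det3 p q r,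
        c = ((r.2 - p.2) * (q'.2 - p'.2) - (q.2 - p.2) * (r'.2 - p'.2)) / det3 p q r &
        d = ((q.1 - p.1) * (r'.2 - p'.2) - (r.1 - p.1) * (q'.2 - p'.2)) / det3 p q r]].
Proof.
move=> D0 DD.
pose a := ((r.2 - p.2) * (q'.1 - p'.1) - (q.2 - p.2) * (r'.1 - p'.1)) / det3 p q r.
pose b := ((q.1 - p.1) * (r'.1 - p'.1) - (r.1 - p.1) * (q'.1 - p'.1)) / det3 p q r.
pose c := ((r.2 - p.2) * (q'.2 - p'.2) - (q.2 - p.2) * (r'.2 - p'.2)) / det3 p q r.
pose d := ((q.1 - p.1) * (r'.2 - p'.2) - (r.1 - p.1) * (q'.2 - p'.2)) / det3 p q r.
exists a, b, c, d, (p'.1 - a * p.1 - b * p.2), (p'.2 - c * p.1 - d * p.2).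
split => //.
- have -> : a * d - b * c = det3 p' q' r' / det3 p q r.
    by rewrite /a /b /c /d; move: D0; rewrite /det3 => D0; field.
  by rewrite -DD divff.
- by rewrite [RHS]surjective_pairing /affine_map; congr pair; ring.
- rewrite [RHS]surjective_pairing /affine_map /a /b /c /d; move: D0; rewrite /det3 => D0.
  by congr pair; field.
- rewrite [RHS]surjective_pairing /affine_map /a /b /c /d; move: D0; rewrite /det3 => D0.
  by congr pair; field.
Qed.

Lemma triangle_ref (s : R) : 0 < s -> triangle (0, 0) (s, 0) (s, s) = ref_triangle s.
Proof.
move=> s0; have sn : s != 0 by rewrite gt_eqF.
apply/seteqP; split => z /=.
  move=> [a [b [c [a0 b0 c0 e1 ->]]]]; split; rewrite /= /GRing.scale /=.
  - by rewrite !mulr0 !add0r mulr_gt0.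
  - by rewrite !mulr0 !add0r addrK mulr_gt0.
  - have -> : s - (a * 0 + b * s + c * s) = a * s by rewrite (_ : a = 1 - b - c); [ring|lra].
    by rewrite mulr_gt0.
move=> [h1 h2 h3]; exists ((s - z.1) / s), ((z.1 - z.2) / s), (z.2 / s).
split; rewrite ?divr_gt0//; first by field.
by rewrite [LHS]surjective_pairing; congr pair; rewrite /= /GRing.scale /=; field.
Qed.

Lemma ref_vertices p q r : 0 < det3 p q r ->
  det3 p q r = det3 (0, 0) (Num.sqrt (det3 p q r), 0) (Num.sqrt (det3 p q r), Num.sqrt (det3 p q r)).
Proof.
by move=> D0; rewrite [RHS]/det3 /= !subr0 mul0r subr0 -expr2 sqr_sqrtr// ltW.
Qed.

Lemma measurable_triangle p q r : 0 < det3 p q r -> measurable (triangle p q r : set plane).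
Proof.
move=> D0; have [|a [b [c [d [e [f [h ep eq er _]]]]]]] := affine_between _ (ref_vertices D0).
  by rewrite gt_eqF.
rewrite -(preimage_triangle e f p q r h) ep eq er triangle_ref ?sqrtr_gt0//.
rewrite -[X in measurable X]setTI; have [mT _] := area_preserving_affine e f h.
exact: (mT measurableT _ (measurable_ref_triangle _)).
Qed.

Definition tri_radius p q r : R :=
  `|p.1| + `|p.2| + (`|q.1| + `|q.2|) + (`|r.1| + `|r.2|).

Lemma triangle_sub_square p q r : triangle p q r `<=` square (tri_radius p q r).
Proof.
move=> z [s [t [w [s0 t0 w0 e1 ->]]]].
have K (u x : R) : 0 < u -> u <= 1 -> `|u * x| <= `|x|.
  by move=> u0 u1; rewrite normrM ger0_norm ?ler_piMl// ltW.
have H (x y u : R) : `|s * x + t * y + w * u| <= `|x| + `|y| + `|u|.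
  apply: (le_trans (ler_normD _ _)); apply: lerD; last by apply: K => //; lra.
  by apply: (le_trans (ler_normD _ _)); apply: lerD; apply: K => //; lra.
have H1 := H p.1 q.1 r.1; have H2 := H p.2 q.2 r.2.
have := (normr_ge0 p.1, normr_ge0 p.2, normr_ge0 q.1, normr_ge0 q.2, normr_ge0 r.1, normr_ge0 r.2).
move=> [[[[[n1 n2] n3] n4] n5] n6].
by split; rewrite /= in_itv /= -ler_norml /GRing.scale /= /tri_radius; lra.
Qed.

(** The parameter runs over [0, 1], so this is the integral of v^2 with respect to
    arc length divided by the length of the side: with this normalization it is
    invariant under affine maps. *)
Definition side_integral (v : R * R -> R) p q : R :=
  \int[lebesgue_measure]_(t in `[0, 1]) v (segment_param p q t) ^+ 2.

(** The divergence theorem for v^2 times the field z - p, which is tangent to the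
    two sides through p.  The identity is invariant under area-preserving affine
    maps, so it follows from the case of the right triangle. *)
Lemma green_triangle (v : R * R -> R) p q r : 0 < det3 p q r -> smooth v ->
  \int[area R]_(z in triangle p q r)
    (2 * v z ^+ 2 + 2 * v z *
      ((z.1 - p.1) * 'D_(e1 R) v z + (z.2 - p.2) * 'D_(e2 R) v z)) =
  det3 p q r * side_integral v q r.
Proof.
move=> D0 sv; set s := Num.sqrt (det3 p q r).
have s0 : 0 < s by rewrite sqrtr_gt0.
have [|a [b [c [d [e [f [h Tp Tq Tr [ea eb ec ed]]]]]]]] :=
  @affine_between (0, 0) (s, 0) (s, s) p q r _ (esym (ref_vertices D0)).
  by rewrite -ref_vertices// gt_eqF.
set T := affine_map a b c d e f in Tp Tq Tr.
have cv := smooth_continuous sv.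
have cD1 := smooth_continuous (smooth_derive (e1 R) sv).
have cD2 := smooth_continuous (smooth_derive (e2 R) sv).
have sV : smooth (v \o T) by exact: smooth_affine.
have cF : continuous (fun z : R * R => 2 * v z ^+ 2 + 2 * v z *
      ((z.1 - p.1) * 'D_(e1 R) v z + (z.2 - p.2) * 'D_(e2 R) v z)).
  move=> z.
  have c1 : (fun z : R * R => z.1) @ z --> z.1 by exact: cvg_fst.
  have c2 : (fun z : R * R => z.2) @ z --> z.2 by exact: cvg_snd.
  have k (l : R) : (fun _ : R * R => l) @ z --> l by exact: cvg_cst.
  have vz := cv z; have d1 := cD1 z; have d2 := cD2 z.
  apply: cvgD; first exact: (cvgM (k 2) (cvgM vz vz)).
  apply: cvgM; first exact: (cvgM (k 2) vz).
  by apply: cvgD; apply: cvgM => //; apply: cvgB.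
rewrite (Rintegral_area_preserving (area_preserving_affine e f h)); last 2 first.
- exact: measurable_triangle.
- exact: measurable_funTS (continuous_measurable_plane cF).
rewrite -[in X in triangle X]Tp -[in X in triangle _ X]Tq -[in X in triangle _ _ X]Tr.
rewrite preimage_triangle// triangle_ref//.
pose w := fun z : R * R => (v \o T) z ^+ 2.
have dw u z : is_derive z u w (2 * v (T z) * 'D_(lin_map a b c d u) v (T z)).
  by have := derive_sqr z u sV; rewrite /T derive_affine.
have DwE (u z : R * R) : 'D_u w z = 2 * v (T z) * 'D_(lin_map a b c d u) v (T z).
  by have dwz := dw u z; rewrite derive_val.
have Dw u : 'D_u w = fun z => 2 * v (T z) * 'D_(lin_map a b c d u) v (T z).
  by apply/funext => z; exact: DwE.
have cT : continuous T by exact: affine_map_continuous.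
have cvT : continuous (v \o T) by exact: smooth_continuous.
have cw : continuous w.
  by move=> z; have vz := cvT z; exact: (cvgM vz vz).
have cDw u : continuous ('D_u w).
  rewrite Dw => z; apply: cvgM.
    have vz := cvT z.
    have k2 : (fun _ : R * R => 2 : R) @ z --> (2 : R) by exact: cvg_cst.
    exact: (cvgM k2 vz).
  have cL := smooth_continuous (smooth_derive (lin_map a b c d u) sv).
  exact: (continuous_comp (cT z) (cL (T z))).
have dw1 z : derivable w z (e1 R) by case: (dw (e1 R) z).
have dw2 z : derivable w z (e2 R) by case: (dw (e2 R) z).
have := @green_ref_triangle R s w cw dw1 dw2 (@cDw _) (@cDw _).
have cws : continuous (fun y : R => w (s, y)) by exact: continuous_vline.
rewrite (Rintegral_scale s0 cws); last by move=> x; rewrite sqr_ge0.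
rewrite mulrA -expr2 sqr_sqrtr ?ltW//.
have -> : \int[lebesgue_measure]_(t in `[0, 1]) w (s, s * t) = side_integral v q r.
  apply: eq_Rintegral => t _; rewrite /w /=; congr (v _ ^+ 2).
  rewrite -Tq -Tr /segment_param /T /affine_map /=; congr pair; ring.
move=> <-; apply: eq_Rintegral => z _; rewrite !DwE /w /=.
rewrite (@smooth_deriveE _ v _ (lin_map a b c d (e1 R)) sv).
rewrite (@smooth_deriveE _ v _ (lin_map a b c d (e2 R)) sv).
by rewrite -Tp /T /affine_map /lin_map /e1 /e2 /=; ring.
Qed.

End triangles.

(** * Trial functions transplanted between triangles *)

Section boundary_integrals.
Variable R : realType.
Notation plane := (measurableTypeR R * measurableTypeR R)%type.
Notation mu := (@lebesgue_measure R).
Implicit Types p q r z : R * R.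

Lemma ge0_integral_mrestr (f : R -> \bar R) (D : set (measurableTypeR R)) (mD : measurable D) :
  measurable_fun setT f -> (forall x, 0 <= f x)%E ->
  (\int[mrestr mu mD]_x f x = \int[mu]_(x in D) f x)%E.
Proof.
move=> mf f0; have mDc : measurable (~` D) by exact: measurableC.
rewrite -(setUv D) ge0_integral_setU//; last 2 first.
- by rewrite setUv.
- by apply/disj_setPS; rewrite setICr.
rewrite [X in (_ + X)%E](_ : _ = 0%E); last first.
  rewrite (eq_measure_integral mzero).
    by rewrite integral_measure_zero.
  by move=> A mA AD; rewrite /= /mrestr (_ : A `&` D = set0) ?measure0//; apply/disjoints_subset.
rewrite adde0; apply: eq_measure_integral => A mA AD.
by rewrite /= /mrestr setIidl.
Qed.

Lemma ge0_segment_integral (f : R * R -> R) p q :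
  continuous f -> (forall z, 0 <= f z) ->
  (\int[segment_length p q]_z (f z)%:E =
   (eucl_dist p q)%:E * \int[mu]_(t in `[0%R, 1%R]) (f (segment_param p q t))%:E)%E.
Proof.
move=> cf f0.
have mf : measurable_fun setT (EFin \o f : plane -> \bar R).
  by apply/measurable_EFinP; exact: continuous_measurable_plane.
have f0E z : (0 <= (EFin \o f) z)%E by rewrite lee_fin.
have msp := measurable_segment_param p q.
apply: (eq_trans (ge0_integral_mscale _ measurableT (NngNum (eucl_dist_ge0 p q)) mf (fun z _ => f0E z))).
congr (_ * _)%E.
apply: (eq_trans (@ge0_integral_pushforward _ _ _ _ _ _ msp (unit_interval_length R)
  setT _ measurableT mf (fun z _ => f0E z))).
rewrite preimage_setT; apply: ge0_integral_mrestr; first exact: (measurableT_comp mf msp).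
by move=> t; exact: f0E.
Qed.

Lemma continuous_segment_param p q : continuous (segment_param p q : R -> R * R).
Proof.
have C (a b : R) : continuous (fun t : R => a + t * b).
  by move=> t; apply: cvgD; [exact: cvg_cst|apply: cvgM; [exact: cvg_id|exact: cvg_cst]].
by move=> t; exact: (cvg_pair (C p.1 (q.1 - p.1) t) (C p.2 (q.2 - p.2) t)).
Qed.

Lemma integrable_segment (f : R * R -> R) p q : continuous f ->
  mu.-integrable `[0, 1] (EFin \o (fun t : R => f (segment_param p q t))).
Proof.
move=> cf; apply: continuous_compact_integrable; first exact: segment_compact.
apply: continuous_subspaceT => t.
exact: (continuous_comp (@continuous_segment_param p q t) (cf _)).
Qed.

Lemma ge0_boundary_integral (f : R * R -> R) p q r :
  continuous f -> (forall z, 0 <= f z) ->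
  (\int[triangle_boundary_length p q r]_z (f z)%:E =
   (eucl_dist p q * \int[mu]_(t in `[0, 1]) f (segment_param p q t) +
    (eucl_dist q r * \int[mu]_(t in `[0, 1]) f (segment_param q r t) +
     eucl_dist r p * \int[mu]_(t in `[0, 1]) f (segment_param r p t)))%R%:E)%E.
Proof.
move=> cf f0.
have mf : measurable_fun setT (EFin \o f : plane -> \bar R).
  by apply/measurable_EFinP; exact: continuous_measurable_plane.
have f0E z : (setT : set plane) z -> (0 <= (EFin \o f) z)%E by rewrite lee_fin.
apply: (eq_trans (@ge0_integral_measure_add _ _ _ (segment_length p q)
  (measure_add (segment_length q r) (segment_length r p)) _ measurableT _ f0E mf)).
rewrite (@ge0_integral_measure_add _ _ _ (segment_length q r) (segment_length r p)
  _ measurableT _ f0E mf).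
have E a b : (\int[segment_length a b]_z (EFin \o f) z =
    (eucl_dist a b * \int[mu]_(t in `[0, 1]) f (segment_param a b t))%:E)%E.
  rewrite EFinM fineK; first exact: ge0_segment_integral.
  by apply: integrable_fin_num => //; exact: integrable_segment.
by rewrite !E.
Qed.

End boundary_integrals.

Section transplantation.
Variable R : realType.
Notation plane := (measurableTypeR R * measurableTypeR R)%type.
Notation mu := (@lebesgue_measure R).
Implicit Types (p q r z : R * R) (v : R * R -> R).

Lemma continuous_sqr v : continuous v -> continuous (fun z => v z ^+ 2).
Proof. by move=> cv z; have vz := cv z; exact: (cvgM vz vz). Qed.

Lemma continuous_sqnorm_grad v : smooth v -> continuous (fun z => sqnorm (grad v z)).
Proof.
move=> sv.
have cD1 := smooth_continuous (smooth_derive (e1 R) sv).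
have cD2 := smooth_continuous (smooth_derive (e2 R) sv).
by move=> z; have d1 := cD1 z; have d2 := cD2 z; exact: (cvgD (cvgM d1 d1) (cvgM d2 d2)).
Qed.

Lemma integrable_triangle v p q r : 0 < det3 p q r -> continuous v ->
  (area R).-integrable (triangle p q r) (EFin \o v).
Proof.
by move=> D0 cv; apply: integrable_plane cv; [exact: measurable_triangle|exact: triangle_sub_square].
Qed.

Lemma square_integrable_triangle v p q r : 0 < det3 p q r -> continuous v ->
  square_integrable (area R) (triangle p q r) v.
Proof.
move=> D0 cv; split; first exact: measurable_funTS (continuous_measurable_plane cv).
apply: integrable_lty; first exact: measurable_triangle.
exact: (integrable_triangle D0 (continuous_sqr cv)).
Qed.

Lemma smooth_is_H1 v p q r : 0 < det3 p q r -> smooth v ->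
  is_H1 (triangle p q r) v (grad v).
Proof.
move=> D0 sv; have mT := measurable_triangle D0.
have sT := @triangle_sub_square _ p q r.
split.
- exact/square_integrable_triangle/smooth_continuous.
- exact/square_integrable_triangle/smooth_continuous/smooth_derive.
- exact/square_integrable_triangle/smooth_continuous/smooth_derive.
- exact: (smooth_weak_derivative mT sT sv (or_introl erefl)).
- exact: (smooth_weak_derivative mT sT sv (or_intror erefl)).
Qed.

Lemma smooth_is_trace v p q r : 0 < det3 p q r -> smooth v ->
  is_trace (triangle p q r) (triangle_boundary_length p q r) v (grad v) v.
Proof.
move=> D0 sv; have cv := smooth_continuous sv; split.
  split; first exact: continuous_measurable_plane.
  rewrite ge0_boundary_integral ?ltry//; first exact: continuous_sqr.
  by move=> z; exact: sqr_ge0.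
exists (fun=> v); split => //.
- under eq_fun do under eq_integral do rewrite subrr expr0n /=.
  by rewrite integral0; exact: cvg_cst.
- under eq_fun do under eq_integral do rewrite subrr /sqnorm /= expr0n /= addr0.
  by rewrite integral0; exact: cvg_cst.
- under eq_fun do under eq_integral do rewrite subrr expr0n /=.
  by rewrite integral0; exact: cvg_cst.
Qed.

Lemma ae_zero_Rintegral_sqr v (D : set (R * R)) : measurable (D : set plane) ->
  continuous v -> {ae area R, forall z, D z -> v z = 0} ->
  \int[area R]_(z in D) v z ^+ 2 = 0.
Proof.
move=> mD cv ae0; rewrite /Rintegral (ae_eq_integral (cst 0%E))//.
- by rewrite integral0.
- apply/measurable_EFinP; apply: measurable_funTS.
  exact: (continuous_measurable_plane (continuous_sqr cv)).
- move: ae0; apply: filterS; first exact: (ae_filter_ringOfSetsType (area R)).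
  by move=> z h Dz; rewrite h// expr0n.
Qed.

Lemma robin_le_smooth (alpha : R) v p q r : 0 < det3 p q r -> smooth v ->
  0 < \int[area R]_(z in triangle p q r) v z ^+ 2 ->
  (triangle_robin_eigenvalue alpha p q r <=
   (rayleigh (triangle p q r) (triangle_boundary_length p q r) alpha v (grad v) v)%:E)%E.
Proof.
move=> D0 sv N0; apply: ereal_inf_lbound; exists v, (grad v), v; split => //.
- exact: smooth_is_H1.
- move=> /(ae_zero_Rintegral_sqr (measurable_triangle D0) (smooth_continuous sv)) N00.
  by rewrite N00 ltxx in N0.
- exact: smooth_is_trace.
Qed.

Lemma boundary_integral_sqr v p q r : continuous v ->
  \int[triangle_boundary_length p q r]_z v z ^+ 2 =
  eucl_dist p q * side_integral v p q + eucl_dist q r * side_integral v q r +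
  eucl_dist r p * side_integral v r p.
Proof.
move=> cv; rewrite /Rintegral (ge0_boundary_integral _ _ _ (continuous_sqr cv)) /=; last first.
  by move=> z; exact: sqr_ge0.
by rewrite addrA.
Qed.

(** The squared norm of the gradient of v o T, where T is the affine map sending
    p' q' r' to p q r, as a quadratic form in the gradient g of v: gq and gr are
    the derivatives of v along two sides of p q r. *)
Definition pulled_sqnorm p' q' r' p q r (g : R * R) : R :=
  let gq := g.1 * (q.1 - p.1) + g.2 * (q.2 - p.2) in
  let gr := g.1 * (r.1 - p.1) + g.2 * (r.2 - p.2) in
  (((r'.2 - p'.2) * gq - (q'.2 - p'.2) * gr) / det3 p' q' r') ^+ 2 +
  (((q'.1 - p'.1) * gr - (r'.1 - p'.1) * gq) / det3 p' q' r') ^+ 2.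

Lemma continuous_pulled_sqnorm v p' q' r' p q r : smooth v ->
  continuous (fun z => pulled_sqnorm p' q' r' p q r (grad v z)).
Proof.
move=> sv.
have cD1 := smooth_continuous (smooth_derive (e1 R) sv).
have cD2 := smooth_continuous (smooth_derive (e2 R) sv).
have lin (K m n L m' n' Q : R) : continuous (fun z : R * R =>
    ((K * ('D_(e1 R) v z * m + 'D_(e2 R) v z * n) -
      L * ('D_(e1 R) v z * m' + 'D_(e2 R) v z * n')) / Q) ^+ 2).
  apply: continuous_sqr => z; have d1 := cD1 z; have d2 := cD2 z.
  have k (l : R) : (fun _ : R * R => l) @ z --> l by exact: cvg_cst.
  by apply: cvgM => //; apply: cvgB; apply: cvgM => //; apply: cvgD; apply: cvgM.
by move=> z; apply: cvgD; exact: lin.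
Qed.

(** The trial function is v o T for the area-preserving affine map T that sends
    p' q' r' to p q r in this order; the change of variables brings every
    integral back to the triangle p q r. *)
Lemma robin_transplant (alpha : R) v p q r p' q' r' :
  0 < det3 p' q' r' -> det3 p' q' r' = det3 p q r -> smooth v ->
  0 < \int[area R]_(z in triangle p q r) v z ^+ 2 ->
  (triangle_robin_eigenvalue alpha p' q' r' <=
   ((\int[area R]_(z in triangle p q r) pulled_sqnorm p' q' r' p q r (grad v z) +
     alpha * (eucl_dist p' q' * side_integral v p q +
              eucl_dist q' r' * side_integral v q r +
              eucl_dist r' p' * side_integral v r p)) /
    \int[area R]_(z in triangle p q r) v z ^+ 2)%:E)%E.
Proof.
move=> D0 DD sv N0.
have [|a [b [c [d [e [f [h Tp Tq Tr [ea eb ec ed]]]]]]]] := affine_between _ DD.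
  by rewrite gt_eqF.
set T := affine_map a b c d e f in Tp Tq Tr.
have sV : smooth (v \o T) by exact: smooth_affine.
have cv := smooth_continuous sv.
have cD1 := smooth_continuous (smooth_derive (e1 R) sv).
have cD2 := smooth_continuous (smooth_derive (e2 R) sv).
have D0' : 0 < det3 p q r by rewrite -DD.
have change (g : R * R -> R) : continuous g ->
    \int[area R]_(z in triangle p q r) g z = \int[area R]_(z in triangle p' q' r') g (T z).
  move=> cg; rewrite (Rintegral_area_preserving (area_preserving_affine e f h)).
  - rewrite -[in X in triangle X]Tp -[in X in triangle _ X]Tq -[in X in triangle _ _ X]Tr.
    by rewrite preimage_triangle.
  - exact: measurable_triangle.
  - exact: measurable_funTS (continuous_measurable_plane cg).
have seg (x y : R * R) (t : R) : T (segment_param x y t) = segment_param (T x) (T y) t.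
  by rewrite /T /affine_map /segment_param /=; congr pair; ring.
have side x y : side_integral (v \o T) x y = side_integral v (T x) (T y).
  by apply: eq_Rintegral => t _; rewrite /= seg.
have NE : \int[area R]_(z in triangle p q r) v z ^+ 2 =
    \int[area R]_(z in triangle p' q' r') (v \o T) z ^+ 2.
  by rewrite (change _ (continuous_sqr cv)).
have := @robin_le_smooth alpha (v \o T) p' q' r' D0 sV.
rewrite -NE => /(_ N0) /le_trans; apply; rewrite lee_fin /rayleigh -NE.
rewrite (boundary_integral_sqr _ _ _ (smooth_continuous sV)) !side Tp Tq Tr.
rewrite (change (fun z => pulled_sqnorm p' q' r' p q r (grad v z))).
  rewrite le_eqVlt; apply/orP; left; apply/eqP; congr ((_ + _) / _).
  apply: eq_Rintegral => z _; rewrite /sqnorm /pulled_sqnorm /grad /T /= !derive_affine.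
  rewrite (@smooth_deriveE _ v _ (lin_map a b c d (e1 R)) sv).
  rewrite (@smooth_deriveE _ v _ (lin_map a b c d (e2 R)) sv).
  rewrite -/T /lin_map /e1 /e2 /= ea eb ec ed.
  by congr (_ ^+ 2 + _ ^+ 2); ring.
exact: continuous_pulled_sqnorm.
Qed.

End transplantation.

(** * The trace inequality and approximation in H^1 *)

Section square_norm_limits.
Context (d : measure_display) (T : measurableType d) (R : realType)
  (mu : {measure set T -> \bar R}) (D : set T).
Hypothesis mD : measurable D.

Lemma square_integrable_integrable (f : T -> R) : square_integrable mu D f ->
  mu.-integrable D (EFin \o (fun x => f x ^+ 2)).
Proof.
move=> [mf f2]; apply/integrableP; split.
  by apply/measurable_EFinP; exact: measurable_funX.
by under eq_integral do rewrite /= ger0_norm ?sqr_ge0//.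
Qed.

Lemma square_integrableB (f g : T -> R) : square_integrable mu D f ->
  square_integrable mu D g -> square_integrable mu D (fun x => f x - g x).
Proof.
move=> sf sg.
have mfg : measurable_fun D (fun x => f x - g x).
  by apply: measurable_funB; [case: sf|case: sg].
have i2 (h : T -> R) : square_integrable mu D h ->
    mu.-integrable D (EFin \o (fun x => 2 * h x ^+ 2)).
  move=> /square_integrable_integrable ih.
  have := integrableZl mD 2 ih.
  by apply: eq_integrable => // x _; rewrite /= EFinM.
split => //; apply: integrable_lty => //.
have := integrableD mD (i2 _ sf) (i2 _ sg); apply: le_integrable => //.
  by apply/measurable_EFinP; exact: measurable_funX.
move=> x _; rewrite /= lee_fin.
have A0 : 0 <= (f x - g x) ^+ 2 by exact: sqr_ge0.
have B0 : 0 <= 2 * f x ^+ 2 + 2 * g x ^+ 2.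
  by have := sqr_ge0 (f x); have := sqr_ge0 (g x); lra.
by rewrite (ger0_norm A0) (ger0_norm B0); have := sqr_ge0 (f x + g x); lra.
Qed.

(** Pointwise, g^2 - f^2 = (g - f)^2 + 2 (g - f) f, and the last term is split by
    Young's inequality. *)
Lemma sqr_Rintegral_diff_le (f g : T -> R) (e : R) : 0 < e ->
  square_integrable mu D f -> square_integrable mu D g ->
  `|\int[mu]_(x in D) g x ^+ 2 - \int[mu]_(x in D) f x ^+ 2| <=
  (1 + e^-1) * \int[mu]_(x in D) (g x - f x) ^+ 2 + e * \int[mu]_(x in D) f x ^+ 2.
Proof.
move=> e0 sf sg; have sgf := square_integrableB sg sf.
have iff_ := square_integrable_integrable sf.
have ig := square_integrable_integrable sg.
have igf := square_integrable_integrable sgf.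
have iZ (k : R) (h : T -> R) : mu.-integrable D (EFin \o h) ->
    mu.-integrable D (EFin \o (fun x => k * h x)).
  move=> ih; have := integrableZl mD k ih.
  by apply: eq_integrable => // x _; rewrite /= EFinM.
have iD (h k : T -> R) : mu.-integrable D (EFin \o h) -> mu.-integrable D (EFin \o k) ->
    mu.-integrable D (EFin \o (fun x => h x + k x)).
  by move=> ih ik; have := integrableD mD ih ik.
have iB (h k : T -> R) : mu.-integrable D (EFin \o h) -> mu.-integrable D (EFin \o k) ->
    mu.-integrable D (EFin \o (fun x => h x - k x)).
  by move=> ih ik; have := integrableB mD ih ik.
rewrite -!RintegralZl// -RintegralB// -RintegralD//; [|exact: iZ|exact: iZ].
apply: (le_trans (le_normr_Rintegral mD (iB _ _ ig iff_))).
apply: le_Rintegral => //.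
- have := iB _ _ ig iff_; exact: integrable_norm.
- by apply: iD; exact: iZ.
move=> x _; set a := f x; set b := g x.
have : 0 <= e^-1 * ((b - a) - e * a) ^+ 2 by rewrite mulr_ge0 ?sqr_ge0// invr_ge0 ltW.
have : 0 <= e^-1 * ((b - a) + e * a) ^+ 2 by rewrite mulr_ge0 ?sqr_ge0// invr_ge0 ltW.
have -> : e^-1 * ((b - a) - e * a) ^+ 2 = e^-1 * (b - a) ^+ 2 - 2 * (b - a) * a + e * a ^+ 2.
  by field; rewrite gt_eqF.
have -> : e^-1 * ((b - a) + e * a) ^+ 2 = e^-1 * (b - a) ^+ 2 + 2 * (b - a) * a + e * a ^+ 2.
  by field; rewrite gt_eqF.
by have := sqr_ge0 (b - a); rewrite ler_norml; nra.
Qed.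

Lemma cvg_sqr_Rintegral (f_ : nat -> T -> R) (f : T -> R) :
  square_integrable mu D f -> (forall n, square_integrable mu D (f_ n)) ->
  (\int[mu]_(x in D) ((f_ n x - f x) ^+ 2)%:E)%E @[n --> \oo] --> 0%E ->
  \int[mu]_(x in D) f_ n x ^+ 2 @[n --> \oo] --> \int[mu]_(x in D) f x ^+ 2.
Proof.
move=> sf sf_ /fine_cvg h0.
have {}h0 : (\int[mu]_(x in D) (f_ n x - f x) ^+ 2) @[n --> \oo] --> (0 : R) by exact: h0.
set B := \int[mu]_(x in D) f x ^+ 2.
have B0 : 0 <= B by apply: Rintegral_ge0 => x _; exact: sqr_ge0.
apply/cvgrPdist_le => /= eps eps0.
(* B + 1 instead of B, which may vanish *)
pose e := eps / (2 * (B + 1)).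
have e0 : 0 < e by rewrite divr_gt0// mulr_gt0// ltr_wpDl.
have e'0 : 0 < eps / 2 / (1 + e^-1) by rewrite divr_gt0 ?divr_gt0// addr_gt0// invr_gt0.
have := h0; move/cvgrPdist_le => /(_ _ e'0); apply: filterS => n.
rewrite sub0r normrN ger0_norm; last by apply: Rintegral_ge0 => x _; exact: sqr_ge0.
rewrite ler_pdivlMr ?addr_gt0 ?invr_gt0// => hn.
rewrite distrC; apply: (le_trans (sqr_Rintegral_diff_le e0 sf (sf_ n))).
have : e * B <= eps / 2.
  rewrite /e mulrAC ler_pdivrMr ?mulr_gt0 ?ltr_wpDl//.
  by have := mulr_ge0 (ltW eps0) B0; lra.
by rewrite mulrC; lra.
Qed.

End square_norm_limits.

Section traces.
Variable R : realType.
Notation plane := (measurableTypeR R * measurableTypeR R)%type.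
Notation mu := (@lebesgue_measure R).
Implicit Types (p q r z : R * R) (v : R * R -> R).

Lemma triangle_rot p q r : triangle p q r = triangle q r p.
Proof.
apply/seteqP; split => z /= [s [t [w [s0 t0 w0 e ->]]]].
  by exists t, w, s; split => //; [lra|rewrite addrAC addrC addrA addrAC].
by exists w, s, t; split => //; [lra|rewrite addrC addrA].
Qed.

Lemma det3_rot p q r : det3 q r p = det3 p q r.
Proof. by rewrite /det3; ring. Qed.

Lemma RintegralD3 (D : set (R * R)) (f g h : R * R -> R) : measurable (D : set plane) ->
  (area R).-integrable D (EFin \o f) -> (area R).-integrable D (EFin \o g) ->
  (area R).-integrable D (EFin \o h) ->
  \int[area R]_(z in D) (f z + g z + h z) =
  \int[area R]_(z in D) f z + \int[area R]_(z in D) g z + \int[area R]_(z in D) h z.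
Proof.
move=> mD i1 i2 i3; rewrite RintegralD//; last by have := integrableD mD i1 i2.
by rewrite RintegralD.
Qed.

Lemma side_integral_cst1 p q : side_integral (cst 1) p q = 1.
Proof.
rewrite /side_integral /= expr1n Rintegral_cst//= lebesgue_measure_itv /= lte_fin ltr01.
by rewrite oppr0 adde0 mulr1.
Qed.

(** The divergence identity for the constant function 1. *)
Lemma area_triangle p q r : 0 < det3 p q r ->
  \int[area R]_(z in triangle p q r) (cst (1 : R) z) ^+ 2 = det3 p q r / 2.
Proof.
move=> D0; have := green_triangle D0 (@smooth_cst R 1).
rewrite side_integral_cst1 mulr1 => <-; have mT := measurable_triangle D0.
pose c1 : R * R -> R := cst 1.
have Dc (w z : R * R) : 'D_w c1 z = 0 by exact: derive_cst.
have -> : \int[area R]_(z in triangle p q r) (2 * c1 z ^+ 2 + 2 * c1 z *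
      ((z.1 - p.1) * 'D_(e1 R) c1 z + (z.2 - p.2) * 'D_(e2 R) c1 z)) =
    \int[area R]_(z in triangle p q r) (2 * c1 z ^+ 2).
  by apply: eq_Rintegral => z _; rewrite !Dc; ring.
rewrite RintegralZl//; first by field.
apply: (@integrable_triangle _ (fun z => c1 z ^+ 2)) => //.
exact: (continuous_sqr (smooth_continuous (@smooth_cst R 1))).
Qed.

(** The sum of the divergence identities of the three vertices has the leading
    term 6 v^2, the only one left when v is constant; the remaining term
    2 v (X . grad v) is split by Young's inequality with the free weight tau. *)
Lemma trace_bound v p q r (tau : R) : 0 < det3 p q r -> smooth v -> 0 < tau ->
  det3 p q r * (side_integral v p q + side_integral v q r + side_integral v r p) <=
  (6 + tau) * \int[area R]_(z in triangle p q r) v z ^+ 2 +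
  72 * tri_radius p q r ^+ 2 / tau * \int[area R]_(z in triangle p q r) sqnorm (grad v z).
Proof.
move=> D0 sv tau0; set L := tri_radius p q r.
have g1 := green_triangle D0 sv.
have D0' : 0 < det3 q r p by rewrite det3_rot.
have g2 := green_triangle D0' sv.
have D0'' : 0 < det3 r p q by rewrite 2!det3_rot.
have g3 := green_triangle D0'' sv.
rewrite det3_rot -triangle_rot in g2.
rewrite 2!det3_rot triangle_rot in g3.
have mT := measurable_triangle D0.
have cv := smooth_continuous sv.
have cD1 := smooth_continuous (smooth_derive (e1 R) sv).
have cD2 := smooth_continuous (smooth_derive (e2 R) sv).
pose G p' z := 2 * v z ^+ 2 + 2 * v z *
  ((z.1 - p'.1) * 'D_(e1 R) v z + (z.2 - p'.2) * 'D_(e2 R) v z).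
have cG p' : continuous (G p').
  move=> z.
  have c1 : (fun z : R * R => z.1) @ z --> z.1 by exact: cvg_fst.
  have c2 : (fun z : R * R => z.2) @ z --> z.2 by exact: cvg_snd.
  have k (l : R) : (fun _ : R * R => l) @ z --> l by exact: cvg_cst.
  have vz := cv z; have d1 := cD1 z; have d2 := cD2 z.
  apply: cvgD; first exact: (cvgM (k 2) (cvgM vz vz)).
  apply: cvgM; first exact: (cvgM (k 2) vz).
  by apply: cvgD; apply: cvgM => //; apply: cvgB.
have csq := continuous_sqnorm_grad sv.
have iT (h : R * R -> R) : continuous h -> (area R).-integrable (triangle p q r) (EFin \o h).
  by move=> ch; exact: integrable_triangle.
have iZ (k : R) (h : R * R -> R) : continuous h ->
    (area R).-integrable (triangle p q r) (EFin \o (fun z => k * h z)).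
  by move=> ch; apply: iT => z; apply: cvgM; [exact: cvg_cst|exact: ch].
rewrite -RintegralZl//; last exact: (iT _ (continuous_sqr cv)).
rewrite -RintegralZl//; last exact: (iT _ csq).
rewrite -[leRHS]RintegralD//; last 2 first.
- exact: (iZ (6 + tau) (fun z => v z ^+ 2) (continuous_sqr cv)).
- exact: (iZ (72 * L ^+ 2 / tau) (fun z => sqnorm (grad v z)) csq).
have -> : det3 p q r * (side_integral v p q + side_integral v q r + side_integral v r p) =
    \int[area R]_(z in triangle p q r) (G p z + G q z + G r z).
  rewrite RintegralD3//; try exact: iT.
  have -> : \int[area R]_(z in triangle p q r) G p z = det3 p q r * side_integral v q r.
    exact: g1.
  have -> : \int[area R]_(z in triangle p q r) G q z = det3 p q r * side_integral v r p.
    exact: g2.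
  have -> : \int[area R]_(z in triangle p q r) G r z = det3 p q r * side_integral v p q.
    exact: g3.
  by ring.
apply: le_Rintegral => //.
- by apply: iT => z; apply: cvgD; [apply: cvgD|]; exact: cG.
- apply: iT => z; apply: cvgD; apply: cvgM; try exact: cvg_cst.
    exact: (continuous_sqr cv).
  exact: csq.
move=> z Tz; rewrite /G /sqnorm /grad /=.
set d1 := 'D_(e1 R) v z; set d2 := 'D_(e2 R) v z.
(* each of the three differences is at most 2 L, hence the bound 6 L on the
   coordinates of X = (X1, X2) and 72 L^2 on its squared norm *)
pose X1 := (z.1 - p.1) + (z.1 - q.1) + (z.1 - r.1).
pose X2 := (z.2 - p.2) + (z.2 - q.2) + (z.2 - r.2).
have [/= hz1 hz2] := triangle_sub_square Tz.
move: hz1 hz2; rewrite !in_itv /= -!ler_norml -/L => hz1 hz2.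
have := (normr_ge0 p.1, normr_ge0 p.2, normr_ge0 q.1, normr_ge0 q.2, normr_ge0 r.1, normr_ge0 r.2).
move=> [[[[[n1 n2] n3] n4] n5] n6].
have LE : L = `|p.1| + `|p.2| + (`|q.1| + `|q.2|) + (`|r.1| + `|r.2|) by [].
have sqL (X : R) : `|X| <= 6 * L -> X ^+ 2 <= 36 * L ^+ 2.
  move=> XL; rewrite -real_normK ?num_real//.
  by have := normr_ge0 X; nra.
have X1L : X1 ^+ 2 <= 36 * L ^+ 2.
  apply: sqL; rewrite ler_norml; move: hz1; rewrite ler_norml => /andP[h1 h2].
  have := (ler_norm p.1, ler_norm q.1, ler_norm r.1, ler_norm (- p.1), ler_norm (- q.1), ler_norm (- r.1)).
  rewrite !normrN => -[[[[[m1 m2] m3] m4] m5] m6].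
  by rewrite /X1; apply/andP; split; lra.
have X2L : X2 ^+ 2 <= 36 * L ^+ 2.
  apply: sqL; rewrite ler_norml; move: hz2; rewrite ler_norml => /andP[h1 h2].
  have := (ler_norm p.2, ler_norm q.2, ler_norm r.2, ler_norm (- p.2), ler_norm (- q.2), ler_norm (- r.2)).
  rewrite !normrN => -[[[[[m1 m2] m3] m4] m5] m6].
  by rewrite /X2; apply/andP; split; lra.
have -> : 2 * v z ^+ 2 + 2 * v z * ((z.1 - p.1) * d1 + (z.2 - p.2) * d2) +
  (2 * v z ^+ 2 + 2 * v z * ((z.1 - q.1) * d1 + (z.2 - q.2) * d2)) +
  (2 * v z ^+ 2 + 2 * v z * ((z.1 - r.1) * d1 + (z.2 - r.2) * d2)) =
  6 * v z ^+ 2 + 2 * v z * (X1 * d1 + X2 * d2) by rewrite /X1 /X2; ring.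
rewrite [(6 + tau) * _]mulrDl -addrA lerD2l.
have h1 : 0 <= tau^-1 * ((tau * v z - (X1 * d1 + X2 * d2)) ^+ 2).
  by rewrite mulr_ge0 ?sqr_ge0// invr_ge0 ltW.
have h2 : (X1 * d1 + X2 * d2) ^+ 2 <= 72 * L ^+ 2 * (d1 ^+ 2 + d2 ^+ 2).
  have -> : (X1 * d1 + X2 * d2) ^+ 2 =
    (X1 ^+ 2 + X2 ^+ 2) * (d1 ^+ 2 + d2 ^+ 2) - (X1 * d2 - X2 * d1) ^+ 2 by ring.
  have := sqr_ge0 (X1 * d2 - X2 * d1).
  have : (X1 ^+ 2 + X2 ^+ 2) * (d1 ^+ 2 + d2 ^+ 2) <= 72 * L ^+ 2 * (d1 ^+ 2 + d2 ^+ 2).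
    by apply: ler_wpM2r; [rewrite addr_ge0 ?sqr_ge0|lra].
  by lra.
have h3 : tau^-1 * (X1 * d1 + X2 * d2) ^+ 2 <= tau^-1 * (72 * L ^+ 2 * (d1 ^+ 2 + d2 ^+ 2)).
  by apply: ler_wpM2l h2; rewrite invr_ge0 ltW.
have e4 : tau^-1 * ((tau * v z - (X1 * d1 + X2 * d2)) ^+ 2) =
   tau * v z ^+ 2 - 2 * v z * (X1 * d1 + X2 * d2) + tau^-1 * (X1 * d1 + X2 * d2) ^+ 2.
  by field; rewrite gt_eqF.
have -> : 72 * L ^+ 2 / tau * (d1 ^+ 2 + d2 ^+ 2) = tau^-1 * (72 * L ^+ 2 * (d1 ^+ 2 + d2 ^+ 2)) by ring.
rewrite e4 in h1.
move: h1 h3; set Y := X1 * d1 + X2 * d2; set Z := tau^-1 * (_ * (d1 ^+ 2 + d2 ^+ 2)); set W := tau^-1 * Y ^+ 2.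
by lra.
Qed.

Lemma admissible_norm_gt0 p q r u : 0 < det3 p q r ->
  square_integrable (area R) (triangle p q r) u ->
  ~ {ae area R, forall z, triangle p q r z -> u z = 0} ->
  0 < \int[area R]_(z in triangle p q r) u z ^+ 2.
Proof.
move=> D0 su nae; have mT := measurable_triangle D0.
have iu := square_integrable_integrable su.
rewrite lt_neqAle Rintegral_ge0 ?andbT; last by move=> z _; exact: sqr_ge0.
apply/eqP => u0; apply: nae.
have mu2 : measurable_fun (triangle p q r : set plane) (EFin \o (fun z => u z ^+ 2)).
  exact: measurable_int iu.
have /(ae_eq_integral_abs (area R) mT mu2) : (\int[area R]_(z in triangle p q r) `|(u z ^+ 2)%:E| = 0)%E.
  under eq_integral do rewrite /= ger0_norm ?sqr_ge0//.
  by rewrite -[LHS]fineK; [congr EFin; exact/esym|exact: integrable_fin_num].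
apply: filterS => z h Tz.
by have [] := h Tz; move=> /eqP; rewrite sqrf_eq0 => /eqP.
Qed.

(** The approximating sequence that defines the trace converges in the three L^2
    spaces at once, so the three quadratic functionals in the Rayleigh quotient
    converge along it. *)
Lemma admissible_approx p q r u Du g : 0 < det3 p q r ->
  is_H1 (triangle p q r) u Du ->
  is_trace (triangle p q r) (triangle_boundary_length p q r) u Du g ->
  exists v : nat -> R * R -> R,
    [/\ forall n, smooth (v n),
     \int[area R]_(z in triangle p q r) v n z ^+ 2 @[n --> \oo] -->
       \int[area R]_(z in triangle p q r) u z ^+ 2,
     \int[area R]_(z in triangle p q r) sqnorm (grad (v n) z) @[n --> \oo] -->
       \int[area R]_(z in triangle p q r) sqnorm (Du z) &
     \int[triangle_boundary_length p q r]_z v n z ^+ 2 @[n --> \oo] -->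
       \int[triangle_boundary_length p q r]_z g z ^+ 2].
Proof.
move=> D0 [su s1 s2 _ _] [sg [v [sv vu vDu vg]]]; exists v.
have mT := measurable_triangle D0.
have cv n := smooth_continuous (sv n).
have cD n e := smooth_continuous (smooth_derive e (sv n)).
have sq n e : square_integrable (area R) (triangle p q r) ('D_e (v n)).
  exact: square_integrable_triangle D0 (cD n e).
have mDu (i : R * R -> R) : i = (fun z => (Du z).1) \/ i = (fun z => (Du z).2) ->
    measurable_fun (triangle p q r : set plane) i.
  by case=> ->; [exact: (proj1 s1)|exact: (proj1 s2)].
have comp e (i : R * R -> R) :
    (forall n z, ('D_e (v n) z - i z) ^+ 2 <= sqnorm (grad (v n) z - Du z)) ->
    measurable_fun (triangle p q r : set plane) i ->
    (\int[area R]_(z in triangle p q r) (('D_e (v n) z - i z) ^+ 2)%:E)%E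
      @[n --> \oo] --> 0%E.
  move=> le mi; apply: (squeeze_cvge _ (cvg_cst 0%E) vDu).
  apply: nearW => n; apply/andP; split.
    by apply: integral_ge0 => z _; rewrite lee_fin sqr_ge0.
  apply: ge0_le_integral => //.
  - by move=> z _; rewrite lee_fin sqr_ge0.
  - apply/measurable_EFinP; apply: measurable_funX; apply: measurable_funB => //.
    exact: (proj1 (sq n e)).
  - apply/measurable_EFinP; apply: measurable_funD; apply: measurable_funX;
      apply: measurable_funB; [exact: (proj1 (sq n (e1 R)))|exact: (proj1 s1)
        |exact: (proj1 (sq n (e2 R)))|exact: (proj1 s2)].
  - by move=> z _; rewrite lee_fin; exact: le.
have c1 := comp (e1 R) (fun z => (Du z).1).
have c2 := comp (e2 R) (fun z => (Du z).2).
have l1 := cvg_sqr_Rintegral mT s1 (fun n => sq n (e1 R))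
  (c1 (fun n z => ltac:(by rewrite /sqnorm /= lerDl sqr_ge0)) (mDu _ (or_introl erefl))).
have l2 := cvg_sqr_Rintegral mT s2 (fun n => sq n (e2 R))
  (c2 (fun n z => ltac:(by rewrite /sqnorm /= lerDr sqr_ge0)) (mDu _ (or_intror erefl))).
have split_sq (a b : R * R -> R) : square_integrable (area R) (triangle p q r) a ->
    square_integrable (area R) (triangle p q r) b ->
    \int[area R]_(z in triangle p q r) (a z ^+ 2 + b z ^+ 2) =
    \int[area R]_(z in triangle p q r) a z ^+ 2 + \int[area R]_(z in triangle p q r) b z ^+ 2.
  by move=> sa sb; rewrite RintegralD//; exact: square_integrable_integrable.
split => //.
- apply: cvg_sqr_Rintegral => // n.
  exact: square_integrable_triangle D0 (cv n).
- rewrite /sqnorm split_sq//.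
  rewrite (_ : (fun n => _) = (fun n =>
    \int[area R]_(z in triangle p q r) 'D_(e1 R) (v n) z ^+ 2 +
    \int[area R]_(z in triangle p q r) 'D_(e2 R) (v n) z ^+ 2)).
    exact: (cvgD l1 l2).
  by apply/funext => n; rewrite -split_sq.
- apply: (cvg_sqr_Rintegral measurableT sg _ vg) => n.
  exact: (proj1 (smooth_is_trace D0 (sv n))).
Qed.

End traces.

(** * The isoperimetric deficit of a triangle *)

Section perimeters.
Variable R : realType.

(** The difference of the two sides is
    (x (y - z)^2 + y (z - x)^2 + z (x - y)^2) / 9. *)
Lemma amgm3_variance (x y z : R) : 0 <= x -> 0 <= y -> 0 <= z ->
  (x + y + z) / 18 * (x ^+ 2 + y ^+ 2 + z ^+ 2 - (x + y + z) ^+ 2 / 3) <=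
  ((x + y + z) / 3) ^+ 3 - x * y * z.
Proof.
move=> x0 y0 z0; rewrite -subr_ge0.
have -> : ((x + y + z) / 3) ^+ 3 - x * y * z -
    (x + y + z) / 18 * (x ^+ 2 + y ^+ 2 + z ^+ 2 - (x + y + z) ^+ 2 / 3) =
  (x * (y - z) ^+ 2 + y * (z - x) ^+ 2 + z * (x - y) ^+ 2) / 9 by field.
by rewrite divr_ge0// !addr_ge0// mulr_ge0// sqr_ge0.
Qed.

Variables (S l0 l1 l2 l3 : R).
Hypotheses (S0 : 0 < S) (l0_gt0 : 0 < l0) (l1_ge0 : 0 <= l1) (l2_ge0 : 0 <= l2)
  (l3_ge0 : 0 <= l3).
Hypothesis heron0 : 3 * l0 ^+ 4 = 16 * S ^+ 2.
Hypothesis heron : (l1 + l2 + l3) * ((l2 + l3 - l1) * (l3 + l1 - l2) * (l1 + l2 - l3)) = 16 * S ^+ 2.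

Let P := l1 + l2 + l3.

Let P_ge0 : 0 <= P. Proof. by rewrite !addr_ge0. Qed.

Let prod_gt0 : 0 < P * ((l2 + l3 - l1) * (l3 + l1 - l2) * (l1 + l2 - l3)).
Proof. by rewrite heron mulr_gt0// exprn_gt0. Qed.

Let P_gt0 : 0 < P.
Proof.
rewrite lt_neqAle P_ge0 andbT; apply/eqP => P0.
by move: prod_gt0; rewrite -P0 mul0r ltxx.
Qed.

Lemma pos_of_pairwise (x y z : R) : 0 < x * y * z -> 0 <= x + y -> 0 <= x + z -> 0 <= x.
Proof.
move=> h xy xz; rewrite leNgt; apply/negP => x0.
have y0 : 0 < y by lra.
have z0 : 0 < z by lra.
have := mulr_gt0 y0 z0; nra.
Qed.

(** With x = P - 2 l1, y = P - 2 l2 and z = P - 2 l3, Heron's formula reads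
    P x y z = 16 S^2.  The right-hand side is fixed, so the defect in the
    inequality of means shows that P >= 3 l0 and bounds by the excess P - 3 l0
    the sum V of the squared deviations of x, y, z from their mean; the sum of
    the squared sides is P^2 / 3 + V / 4. *)
Lemma isoperimetric_deficit :
  3 * l0 <= P /\ 3 * (l1 ^+ 2 + l2 ^+ 2 + l3 ^+ 2 - 3 * l0 ^+ 2) <= 4 * P * (P - 3 * l0).
Proof.
set x := l2 + l3 - l1; set y := l3 + l1 - l2; set z := l1 + l2 - l3.
have xyz0 : 0 < x * y * z by have := prod_gt0; rewrite pmulr_rgt0.
have xy : x + y = l3 + l3 by rewrite /x /y; ring.
have xz : x + z = l2 + l2 by rewrite /x /z; ring.
have yz : y + z = l1 + l1 by rewrite /y /z; ring.
have x0 : 0 <= x by apply: (pos_of_pairwise xyz0); rewrite ?xy ?xz addr_ge0.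
have y0 : 0 <= y.
  have yxz0 : 0 < y * x * z by rewrite [y * x]mulrC.
  by apply: (pos_of_pairwise yxz0); rewrite ?[y + x]addrC ?xy ?yz addr_ge0.
have z0 : 0 <= z.
  have zxy0 : 0 < z * x * y by rewrite -mulrA mulrC.
  by apply: (pos_of_pairwise zxy0); rewrite ?[z + x]addrC ?[z + y]addrC ?xz ?yz addr_ge0.
have := amgm3_variance x0 y0 z0.
have -> : x + y + z = P by rewrite /x /y /z /P; ring.
set V := x ^+ 2 + y ^+ 2 + z ^+ 2 - P ^+ 2 / 3 => hV.
have V0 : 0 <= V.
  have -> : V = ((x - y) ^+ 2 + (y - z) ^+ 2 + (z - x) ^+ 2) / 3.
    by rewrite /V /x /y /z /P; field.
  by rewrite divr_ge0// !addr_ge0// sqr_ge0.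
have h4 : P ^+ 2 * V / 18 <= (P ^+ 4 - (3 * l0) ^+ 4) / 27.
  have -> : P ^+ 2 * V / 18 = P * (P / 18 * V) by ring.
  have -> : (P ^+ 4 - (3 * l0) ^+ 4) / 27 = P * ((P / 3) ^+ 3 - x * y * z).
    have -> : P * ((P / 3) ^+ 3 - x * y * z) = P ^+ 4 / 27 - P * (x * y * z) by field.
    by rewrite heron -heron0; field.
  by rewrite ler_pM2l.
have P0le : 3 * l0 <= P.
  have : (3 * l0) ^+ 4 <= P ^+ 4.
    have : 0 <= P ^+ 2 * V / 18 by rewrite divr_ge0// mulr_ge0// sqr_ge0.
    by lra.
  by rewrite ler_pXn2r// nnegrE// mulr_ge0// ltW.
split => //.
have d0 : 0 <= P - 3 * l0 by rewrite subr_ge0.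
have h5 : (P ^+ 4 - (3 * l0) ^+ 4) / 27 <= 4 * P ^+ 3 * (P - 3 * l0) / 27.
  rewrite ler_pM2r//.
  have -> : P ^+ 4 - (3 * l0) ^+ 4 =
    (P + 3 * l0) * (P ^+ 2 + (3 * l0) ^+ 2) * (P - 3 * l0) by ring.
  apply: ler_wpM2r => //.
  have -> : 4 * P ^+ 3 = (P + P) * (P ^+ 2 + P ^+ 2) by ring.
  have l00 := ltW l0_gt0.
  apply: ler_pM; rewrite ?addr_ge0 ?sqr_ge0 ?mulr_ge0//; first by rewrite lerD2l.
  by rewrite lerD2l ler_pXn2r// nnegrE// mulr_ge0.
have h6 : V <= 8 / 3 * P * (P - 3 * l0).
  have P2 : 0 < P ^+ 2 by rewrite exprn_gt0.
  rewrite -(ler_pM2l P2).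
  have -> : P ^+ 2 * (8 / 3 * P * (P - 3 * l0)) = 18 * (4 * P ^+ 3 * (P - 3 * l0) / 27) by field.
  by lra.
have -> : l1 ^+ 2 + l2 ^+ 2 + l3 ^+ 2 = P ^+ 2 / 3 + V / 4.
  by rewrite /V /x /y /z /P; field.
have : 0 <= P * (P - 3 * l0) by rewrite mulr_ge0.
have : 0 <= (P - 3 * l0) * (P - 3 * l0) by rewrite mulr_ge0.
by nra.
Qed.

Lemma isoperimetric_equality : P = 3 * l0 -> l1 ^+ 2 + l2 ^+ 2 + l3 ^+ 2 = 3 * l0 ^+ 2.
Proof.
move=> PE; have [_] := isoperimetric_deficit; rewrite PE subrr mulr0 => h.
apply/eqP; rewrite eq_le; apply/andP; split; first by lra.
have -> : 3 * l0 ^+ 2 = P ^+ 2 / 3 by rewrite PE; field.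
rewrite -subr_ge0.
have -> : l1 ^+ 2 + l2 ^+ 2 + l3 ^+ 2 - P ^+ 2 / 3 =
  ((l1 - l2) ^+ 2 + (l2 - l3) ^+ 2 + (l3 - l1) ^+ 2) / 3 by rewrite /P; field.
by rewrite divr_ge0// !addr_ge0// sqr_ge0.
Qed.

End perimeters.

(** * Averaging over the rotations of the equilateral triangle *)

Section equilateral.
Variables (R : realType) (k : R).
Hypothesis k_gt0 : 0 < k.
Notation S := (Num.sqrt 3 * k ^+ 2).
Notation P0 := ((- k, 0) : R * R).
Notation Q0 := ((k, 0) : R * R).
Notation R0 := ((0, Num.sqrt 3 * k) : R * R).

Let s3 : Num.sqrt 3 ^+ 2 = 3 :> R. Proof. by rewrite sqr_sqrtr. Qed.
Let s3_gt0 : 0 < Num.sqrt 3 :> R. Proof. by rewrite sqrtr_gt0. Qed.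

Lemma det3_equilateral : det3 P0 Q0 R0 = 2 * S.
Proof. by rewrite /det3 /=; ring. Qed.

Lemma sides_equilateral :
  [/\ eucl_dist P0 Q0 = 2 * k, eucl_dist Q0 R0 = 2 * k & eucl_dist R0 P0 = 2 * k].
Proof.
have k2 : 0 <= 2 * k by rewrite mulr_ge0// ltW.
split; rewrite /eucl_dist /=.
- have -> : (k - - k) ^+ 2 + (0 - 0) ^+ 2 = (2 * k) ^+ 2 by ring.
  by rewrite sqrtr_sqr ger0_norm.
- have -> : (0 - k) ^+ 2 + (Num.sqrt 3 * k - 0) ^+ 2 = (2 * k) ^+ 2.
    by rewrite subr0 sub0r sqrrN exprMn s3; ring.
  by rewrite sqrtr_sqr ger0_norm.
- have -> : (- k - 0) ^+ 2 + (0 - Num.sqrt 3 * k) ^+ 2 = (2 * k) ^+ 2.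
    by rewrite subr0 sub0r !sqrrN exprMn s3; ring.
  by rewrite sqrtr_sqr ger0_norm.
Qed.

Variables (a c y : R).
Hypothesis S_eq : c * y = S.
Notation P1 := ((- c, 0) : R * R).
Notation Q1 := ((c, 0) : R * R).
Notation R1 := ((a, y) : R * R).

Lemma det3_apex : det3 P1 Q1 R1 = 2 * S.
Proof. by rewrite -S_eq /det3 /=; ring. Qed.

(** The sum of the squared sides of the triangle with base from (-c, 0) to (c, 0)
    and apex (a, y), divided by the one of the equilateral triangle of side 2 k. *)
Definition energy_ratio : R := (3 * c ^+ 2 + a ^+ 2 + y ^+ 2) / (6 * k ^+ 2).

(** The derivatives A1, A2, A3 of v along the three sides of T0 add up to zero, and
    the sum of their squares is proportional to the squared gradient.  Summed
    over the cyclic matchings, the mixed terms become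
    - (A1^2 + A2^2 + A3^2) / 2, so that only this sum is left. *)
Lemma pulled_sqnorm_sum (g : R * R) :
  pulled_sqnorm P1 Q1 R1 P0 Q0 R0 g + pulled_sqnorm P1 Q1 R1 Q0 R0 P0 g +
  pulled_sqnorm P1 Q1 R1 R0 P0 Q0 g = 3 * energy_ratio * sqnorm g.
Proof.
rewrite /pulled_sqnorm det3_apex /sqnorm /energy_ratio /=.
set h := Num.sqrt 3 * k; set g1 := g.1; set g2 := g.2; set E := 2 * S.
have h2 : h ^+ 2 = 3 * k ^+ 2 by rewrite /h exprMn s3.
have E2 : E ^+ 2 = 12 * k ^+ 4 by rewrite /E !exprMn s3; ring.
transitivity (E ^- 2 * ((6 * k ^+ 2 * g1 ^+ 2 + 2 * h ^+ 2 * g2 ^+ 2) * (3 * c ^+ 2 + a ^+ 2 + y ^+ 2))).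
  by rewrite -exprVn; ring.
by rewrite E2 h2; field; rewrite gt_eqF.
Qed.

End equilateral.

Section comparison.
Variables (R : realType) (k a c y alpha : R).
Hypotheses (k_gt0 : 0 < k) (S_eq : c * y = Num.sqrt 3 * k ^+ 2).
Notation S := (Num.sqrt 3 * k ^+ 2).
Notation P0 := ((- k, 0) : R * R).
Notation Q0 := ((k, 0) : R * R).
Notation R0 := ((0, Num.sqrt 3 * k) : R * R).
Notation P1 := ((- c, 0) : R * R).
Notation Q1 := ((c, 0) : R * R).
Notation R1 := ((a, y) : R * R).
Notation T0 := (triangle P0 Q0 R0).
Notation lambda := (triangle_robin_eigenvalue alpha P1 Q1 R1).

Let S_gt0 : 0 < S. Proof. by rewrite mulr_gt0 ?sqrtr_gt0 ?exprn_gt0. Qed.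
Let D0_gt0 : 0 < det3 P0 Q0 R0. Proof. by rewrite det3_equilateral mulr_gt0. Qed.
Let D1_gt0 : 0 < det3 P1 Q1 R1. Proof. by rewrite (det3_apex a S_eq) mulr_gt0. Qed.
Let DD : det3 P1 Q1 R1 = det3 P0 Q0 R0.
Proof. by rewrite (det3_apex a S_eq) det3_equilateral. Qed.

Definition perimeter (p q r : R * R) : R :=
  eucl_dist p q + eucl_dist q r + eucl_dist r p.

Lemma le_mean3 (l : \bar R) (x1 x2 x3 : R) :
  (l <= x1%:E)%E -> (l <= x2%:E)%E -> (l <= x3%:E)%E ->
  (l <= ((x1 + x2 + x3) / 3)%:E)%E.
Proof.
case: l => [l| |] //; rewrite ?leNye// !lee_fin => h1 h2 h3.
by rewrite ler_pdivlMr//; lra.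
Qed.

(** The least of the three transplanted quotients is at most their mean. *)
Lemma robin_le_average (v : R * R -> R) : smooth v ->
  0 < \int[area R]_(z in T0) v z ^+ 2 ->
  (lambda <= ((energy_ratio k a c y * \int[area R]_(z in T0) sqnorm (grad v z) +
     alpha * (perimeter P1 Q1 R1 / (6 * k) *
       \int[triangle_boundary_length P0 Q0 R0]_z v z ^+ 2)) /
     \int[area R]_(z in T0) v z ^+ 2)%:E)%E.
Proof.
move=> sv N0.
have t1 := robin_transplant alpha D1_gt0 DD sv N0.
have N02 : 0 < \int[area R]_(z in triangle Q0 R0 P0) v z ^+ 2 by rewrite -triangle_rot.
have t2 := robin_transplant alpha D1_gt0 (etrans DD (esym (det3_rot P0 Q0 R0))) sv N02.
have N03 : 0 < \int[area R]_(z in triangle R0 P0 Q0) v z ^+ 2 by rewrite triangle_rot.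
have t3 := robin_transplant alpha D1_gt0 (etrans DD (det3_rot R0 P0 Q0)) sv N03.
rewrite -triangle_rot in t2; rewrite triangle_rot in t3.
apply: (le_trans (le_mean3 t1 t2 t3)); rewrite lee_fin le_eqVlt; apply/orP; left; apply/eqP.
set N := \int[area R]_(z in T0) v z ^+ 2.
have cv := smooth_continuous sv.
rewrite (boundary_integral_sqr _ _ _ cv).
have [-> -> ->] := sides_equilateral k_gt0.
have iT (h : R * R -> R) : continuous h -> (area R).-integrable T0 (EFin \o h).
  by move=> ch; exact: integrable_triangle.
have csq := continuous_sqnorm_grad sv.
have EE : \int[area R]_(z in T0) pulled_sqnorm P1 Q1 R1 P0 Q0 R0 (grad v z) +
    \int[area R]_(z in T0) pulled_sqnorm P1 Q1 R1 Q0 R0 P0 (grad v z) +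
    \int[area R]_(z in T0) pulled_sqnorm P1 Q1 R1 R0 P0 Q0 (grad v z) =
    3 * energy_ratio k a c y * \int[area R]_(z in T0) sqnorm (grad v z).
  rewrite -RintegralZl; [|exact: measurable_triangle|exact: iT csq].
  rewrite -RintegralD3; [|exact: measurable_triangle|exact/iT/continuous_pulled_sqnorm..].
  by apply: eq_Rintegral => z _; rewrite (pulled_sqnorm_sum k_gt0 a S_eq).
transitivity ((\int[area R]_(z in T0) pulled_sqnorm P1 Q1 R1 P0 Q0 R0 (grad v z) +
    \int[area R]_(z in T0) pulled_sqnorm P1 Q1 R1 Q0 R0 P0 (grad v z) +
    \int[area R]_(z in T0) pulled_sqnorm P1 Q1 R1 R0 P0 Q0 (grad v z) +
    alpha * (perimeter P1 Q1 R1 * (side_integral v P0 Q0 + side_integral v Q0 R0 +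
      side_integral v R0 P0))) / 3 / N).
  by rewrite /perimeter; field; rewrite gt_eqF.
by rewrite EE; field; rewrite !gt_eqF.
Qed.

Notation sigma0 := (triangle_boundary_length P0 Q0 R0).
Notation m := (2 * k / (2 * S)).
Notation K := (72 * tri_radius P0 Q0 R0 ^+ 2).
Notation ratio := (perimeter P1 Q1 R1 / (6 * k)).

Lemma boundary_le_smooth (v : R * R -> R) (tau : R) : smooth v -> 0 < tau ->
  \int[sigma0]_z v z ^+ 2 <=
  m * ((6 + tau) * \int[area R]_(z in T0) v z ^+ 2 +
       K / tau * \int[area R]_(z in T0) sqnorm (grad v z)).
Proof.
move=> sv tau0; have := trace_bound D0_gt0 sv tau0.
rewrite (boundary_integral_sqr _ _ _ (smooth_continuous sv)) det3_equilateral.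
have [-> -> ->] := sides_equilateral k_gt0 => h.
have S2 : 0 < 2 * S by rewrite mulr_gt0.
rewrite -!mulrDr [leRHS]mulrAC ler_pdivlMr// -[leLHS]mulrA.
by rewrite ler_pM2l ?mulr_gt0// [leLHS]mulrC.
Qed.

(** The trial function is constant; 6 m is the perimeter of T0 divided by its
    area. *)
Lemma robin_le_perimeter : (lambda <= (alpha * ratio * (6 * m))%:E)%E.
Proof.
have s1 := @smooth_cst R 1.
have N1 := area_triangle D0_gt0; rewrite det3_equilateral in N1.
have N0 : 0 < \int[area R]_(z in T0) (cst (1 : R) z) ^+ 2.
  by rewrite N1 divr_gt0// mulr_gt0.
apply: (le_trans (robin_le_average s1 N0)); rewrite lee_fin N1.
have -> : \int[area R]_(z in T0) sqnorm (grad (cst (1 : R)) z) = 0.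
  rewrite -[RHS](Rintegral_set0 (area R) (cst (0 : R))) Rintegral_mkcond [RHS]Rintegral_mkcond.
  apply: eq_Rintegral => z _; rewrite !patchE; case: ifP => _; case: ifP => _ //;
    by rewrite /sqnorm /grad /= !(derive_cst (1 : R)) expr0n /= addr0.
rewrite (boundary_integral_sqr _ _ _ (smooth_continuous s1)) !side_integral_cst1.
have [-> -> ->] := sides_equilateral k_gt0.
rewrite le_eqVlt; apply/orP; left; apply/eqP.
by field; rewrite !gt_eqF// sqrtr_gt0.
Qed.

Section admissible.
Variables (u g : R * R -> R) (Du : R * R -> R * R).
Hypotheses (uH1 : is_H1 T0 u Du)
  (u_neq0 : ~ {ae area R, forall z, T0 z -> u z = 0})
  (u_trace : is_trace T0 sigma0 u Du g).

Let N := \int[area R]_(z in T0) u z ^+ 2.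
Let E := \int[area R]_(z in T0) sqnorm (Du z).
Let Bd := \int[sigma0]_z g z ^+ 2.

Let N_gt0 : 0 < N.
Proof. by case: uH1 => su _ _ _ _; exact: admissible_norm_gt0. Qed.

Lemma robin_le_average_H1 :
  (lambda <= ((energy_ratio k a c y * E + alpha * (ratio * Bd)) / N)%:E)%E.
Proof.
have [v [sv vN vE vB]] := admissible_approx D0_gt0 uH1 u_trace.
set rho := energy_ratio k a c y.
have lim : ((rho * \int[area R]_(z in T0) sqnorm (grad (v n) z) +
     alpha * (ratio * \int[sigma0]_z v n z ^+ 2)) /
     \int[area R]_(z in T0) v n z ^+ 2) @[n --> \oo] -->
    (rho * E + alpha * (ratio * Bd)) / N.
  apply: cvgM; last by apply: cvgV => //; rewrite gt_eqF.
  apply: cvgD; apply: cvgM => //; try exact: cvg_cst.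
  by apply: cvgM => //; exact: cvg_cst.
have near_le : \forall n \near \oo, (lambda <= ((rho * \int[area R]_(z in T0) sqnorm (grad (v n) z) +
     alpha * (ratio * \int[sigma0]_z v n z ^+ 2)) /
     \int[area R]_(z in T0) v n z ^+ 2)%:E)%E.
  have Npos := cvgr_gt _ vN _ N_gt0.
  near=> n; apply: robin_le_average => //; near: n; exact: Npos.
move: near_le; case: lambda => [l| |] near_le.
- rewrite lee_fin; apply: (ler_cvg_to (cvg_cst l) lim).
  by move: near_le; apply: filterS => n; rewrite lee_fin.
- have [n _ /(_ n (leqnn n))] := near_le.
  by rewrite leye_eq.
- exact: leNye.
Unshelve. all: by end_near.
Qed.

Lemma boundary_le_H1 (tau : R) : 0 < tau -> Bd <= m * ((6 + tau) * N + K / tau * E).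
Proof.
move=> tau0; have [v [sv vN vE vB]] := admissible_approx D0_gt0 uH1 u_trace.
apply: (ler_cvg_to vB).
  apply: cvgM; first exact: cvg_cst.
  apply: cvgD.
    by apply: cvgM; [exact: cvg_cst|exact: vN].
  by apply: cvgM; [exact: cvg_cst|exact: vE].
by apply: nearW => n; exact: boundary_le_smooth.
Qed.

End admissible.

End comparison.

(** * The gap between the eigenvalues *)

Section gap.
Variables (R : realType).

(** N, E, B are the squared norm, the energy and the boundary term of a trial
    function whose quotient is at most alpha 6 m, that of the constants.  The
    choice tau = - 2 alpha m K absorbs half of E in the trace inequality, which
    leaves E <= 4 alpha^2 m^2 K N. *)
Lemma rayleigh_gap (N E B alpha m K C rho p : R) :
  0 < N -> 0 <= E -> alpha < 0 -> 0 < m -> 0 < K -> 1 < p -> 0 <= C ->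
  rho - 1 <= C * (p - 1) -> 4 * C * m * K * - alpha <= 3 ->
  B <= m * ((6 + 2 * - alpha * m * K) * N + K / (2 * - alpha * m * K) * E) ->
  E + alpha * B <= alpha * (6 * m) * N ->
  rho * E + alpha * (p * B) + - alpha * (p - 1) * (3 * m) * N <= E + alpha * B.
Proof.
have [b ->] : exists b, alpha = - b by exists (- alpha); rewrite opprK.
rewrite !opprK oppr_lt0 => N0 E0 b0 m0 K0 p1 C0 rhoC small hB hR.
have {}hR : E <= b * (B - 6 * m * N) by lra.
have hE : E <= 4 * b ^+ 2 * m ^+ 2 * K * N.
  have h : b * (B - 6 * m * N) <= b * (m * ((2 * b * m * K) * N + K / (2 * b * m * K) * E)).
    by rewrite ler_pM2l//; lra.
  have e : b * (m * ((2 * b * m * K) * N + K / (2 * b * m * K) * E)) =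
     2 * b ^+ 2 * m ^+ 2 * K * N + E / 2 by field; rewrite !gt_eqF.
  by rewrite e in h; lra.
have hB6 : 6 * m * N <= B.
  rewrite -subr_ge0 -(pmulr_rge0 _ b0); exact: le_trans hR.
have p10 : 0 < p - 1 by rewrite subr_gt0.
have hCE : C * E <= 3 * b * m * N.
  apply: (le_trans (ler_wpM2l C0 hE)).
  have -> : C * (4 * b ^+ 2 * m ^+ 2 * K * N) = (4 * C * m * K * b) * (b * m * N) by ring.
  have -> : 3 * b * m * N = 3 * (b * m * N) by ring.
  by apply: ler_wpM2r => //; rewrite !mulr_ge0// ltW.
have h1 : (rho - 1) * E <= (p - 1) * (3 * b * m * N).
  apply: (le_trans (ler_wpM2r E0 rhoC)).
  by rewrite mulrAC mulrC; apply: ler_wpM2l => //; exact: ltW.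
have h2 : (p - 1) * b * (6 * m * N) <= (p - 1) * b * B.
  by rewrite ler_pM2l// mulr_gt0.
have -> : rho * E + - b * (p * B) + b * (p - 1) * (3 * m) * N =
  (rho - 1) * E + E - ((p - 1) * b * B + b * B) + (p - 1) * (3 * b * m * N) by ring.
have e3 : (p - 1) * b * (6 * m * N) = 2 * ((p - 1) * (3 * b * m * N)) by ring.
by rewrite e3 in h2; rewrite mulNr; lra.
Qed.

(** Here tau = - alpha m K makes the energy in the trace inequality cancel E
    exactly. *)
Lemma rayleigh_lower (N E B alpha m K : R) :
  0 < N -> alpha < 0 -> 0 < m -> 0 < K ->
  B <= m * ((6 + - alpha * m * K) * N + K / (- alpha * m * K) * E) ->
  alpha * m * (6 + - alpha * m * K) * N <= E + alpha * B.
Proof.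
have [b ->] : exists b, alpha = - b by exists (- alpha); rewrite opprK.
rewrite !opprK oppr_lt0 => N0 b0 m0 K0 hB.
have h : b * B <= b * (m * ((6 + b * m * K) * N + K / (b * m * K) * E)).
  by rewrite ler_pM2l.
have e : b * (m * ((6 + b * m * K) * N + K / (b * m * K) * E)) =
  b * m * (6 + b * m * K) * N + E by field; rewrite !gt_eqF.
by rewrite e in h; rewrite !mulNr; lra.
Qed.

End gap.

Section strict_comparison.
Variables (R : realType) (k a c y alpha C : R).
Hypotheses (k_gt0 : 0 < k) (S_eq : c * y = Num.sqrt 3 * k ^+ 2) (alpha_lt0 : alpha < 0).
Notation S := (Num.sqrt 3 * k ^+ 2).
Notation P0 := ((- k, 0) : R * R).
Notation Q0 := ((k, 0) : R * R).
Notation R0 := ((0, Num.sqrt 3 * k) : R * R).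
Notation P1 := ((- c, 0) : R * R).
Notation Q1 := ((c, 0) : R * R).
Notation R1 := ((a, y) : R * R).
Notation m := (2 * k / (2 * S)).
Notation K := (72 * tri_radius P0 Q0 R0 ^+ 2).
Notation ratio := (perimeter P1 Q1 R1 / (6 * k)).
Hypotheses (C_ge0 : 0 <= C) (ratio_gt1 : 1 < ratio)
  (energy_le : energy_ratio k a c y - 1 <= C * (ratio - 1))
  (alpha_small : 4 * C * m * K * - alpha <= 3).

(** Every quotient on T0 exceeds the eigenvalue of the other triangle by at least
    the same amount eta.  As the infimum over T0 is also bounded below, the
    inequality between the eigenvalues is strict. *)
Lemma robin_lt_equilateral :
  (triangle_robin_eigenvalue alpha P1 Q1 R1 < triangle_robin_eigenvalue alpha P0 Q0 R0)%E.
Proof.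
set l1 := triangle_robin_eigenvalue alpha P1 Q1 R1.
have S_gt0 : 0 < S by rewrite mulr_gt0 ?sqrtr_gt0 ?exprn_gt0.
have D0_gt0 : 0 < det3 P0 Q0 R0 by rewrite det3_equilateral mulr_gt0.
have m_gt0 : 0 < m by rewrite divr_gt0 ?mulr_gt0.
have K_gt0 : 0 < K.
  rewrite mulr_gt0// exprn_gt0// /tri_radius /=.
  by rewrite !ltr_wpDr// ?addr_ge0// normrN normr_gt0 gt_eqF.
pose eta := - alpha * (ratio - 1) * (3 * m).
have eta_gt0 : 0 < eta.
  apply: mulr_gt0; last by rewrite mulr_gt0.
  by apply: mulr_gt0; rewrite ?oppr_gt0 ?subr_gt0.
pose low := alpha * m * (6 + - alpha * m * K).
have main u Du g : is_H1 (triangle P0 Q0 R0) u Du ->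
    ~ {ae area R, forall z, triangle P0 Q0 R0 z -> u z = 0} ->
    is_trace (triangle P0 Q0 R0) (triangle_boundary_length P0 Q0 R0) u Du g ->
    (low <= rayleigh (triangle P0 Q0 R0) (triangle_boundary_length P0 Q0 R0) alpha u Du g) /\
    (l1 + eta%:E <=
      (rayleigh (triangle P0 Q0 R0) (triangle_boundary_length P0 Q0 R0) alpha u Du g)%:E)%E.
  move=> uH1 une utr; rewrite /rayleigh.
  have hB tau := @boundary_le_H1 R k k_gt0 u g Du uH1 utr tau.
  have hav := @robin_le_average_H1 R k a c y alpha k_gt0 S_eq u g Du uH1 une utr.
  have N0 : 0 < \int[area R]_(z in triangle P0 Q0 R0) u z ^+ 2.
    by case: uH1 => su _ _ _ _; exact: admissible_norm_gt0.
  have E0 : 0 <= \int[area R]_(z in triangle P0 Q0 R0) sqnorm (Du z).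
    by apply: Rintegral_ge0 => z _; rewrite addr_ge0 ?sqr_ge0.
  move: hB hav N0 E0.
  set N := \int[area R]_(z in _) u z ^+ 2; set E := \int[area R]_(z in _) sqnorm _.
  set B := \int[triangle_boundary_length _ _ _]_z g z ^+ 2 => hB hav N0 E0.
  have b0 : 0 < - alpha by rewrite oppr_gt0.
  split.
    rewrite ler_pdivlMr//; apply: (@rayleigh_lower _ N E B alpha m K) => //.
    by apply: hB; exact: (mulr_gt0 (mulr_gt0 b0 m_gt0) K_gt0).
  have [small|large] := leP (E + alpha * B) (alpha * (6 * m) * N).
    have gap := @rayleigh_gap R N E B alpha m K C (energy_ratio k a c y) ratio N0 E0 alpha_lt0
      m_gt0 K_gt0 ratio_gt1 C_ge0 energy_le alpha_small
      (hB _ (mulr_gt0 (mulr_gt0 (mulr_gt0 (ltr0n _ 2) b0) m_gt0) K_gt0)) small.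
    apply: (le_trans (leeD2r _ hav)); rewrite -EFinD lee_fin.
    rewrite ler_pdivlMr// mulrDl divfK ?gt_eqF//.
  apply: (le_trans (leeD2r _ (@robin_le_perimeter R k a c y alpha k_gt0 S_eq))).
  rewrite -EFinD lee_fin ler_pdivlMr//; apply: (le_trans _ (ltW large)).
  apply: ler_wpM2r; first exact: ltW.
  rewrite -/m /eta.
  have := mulr_gt0 (mulr_gt0 b0 (_ : 0 < ratio - 1)) m_gt0.
  by rewrite subr_gt0 => /(_ ratio_gt1); set p := ratio; nra.
have low_le : (low%:E <= triangle_robin_eigenvalue alpha P0 Q0 R0)%E.
  apply: le_ereal_inf_tmp => _ [u [Du [g [h1 h2 h3 ->]]]]; rewrite lee_fin.
  by have [] := main u Du g h1 h2 h3.
have gap_le : (l1 + eta%:E <= triangle_robin_eigenvalue alpha P0 Q0 R0)%E.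
  apply: le_ereal_inf_tmp => _ [u [Du [g [h1 h2 h3 ->]]]].
  by have [] := main u Du g h1 h2 h3.
have := @robin_le_perimeter R k a c y alpha k_gt0 S_eq.
move: gap_le; rewrite -/l1; clear main; case: l1 => [l| |] //.
- move=> gap_le _; apply: lt_le_trans gap_le.
  by rewrite -EFinD lte_fin ltrDl.
- by move=> _ _; apply: lt_le_trans low_le; exact: ltNyr.
Qed.

End strict_comparison.

Theorem theorem4p2 (R : realType) (S A B M : R)
    (hS : 0 < S) (hA : 0 < A) (hB : 0 < B) (hM : 0 < M) (hAB : A < B) :
  exists alphac : R,
    alphac < 0 /\
    forall alpha a c : R,
      alphac <= alpha -> alpha < 0 ->
      `|a| <= M ->
      A <= c -> c <= B ->
      (a, c) <> (0, Num.sqrt (S / Num.sqrt 3)) ->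
      (lambda1 S alpha a c < lambda1 S alpha 0 (Num.sqrt (S / Num.sqrt 3)))%E.
Proof.
set k := Num.sqrt (S / Num.sqrt 3).
have s3 : 0 < Num.sqrt 3 :> R by rewrite sqrtr_gt0.
have s32 : Num.sqrt 3 ^+ 2 = 3 :> R by rewrite sqr_sqrtr.
have k0 : 0 < k by rewrite sqrtr_gt0 divr_gt0.
have k2 : k ^+ 2 = S / Num.sqrt 3 by rewrite sqr_sqrtr// divr_ge0// ltW.
have SE : S = Num.sqrt 3 * k ^+ 2 by rewrite k2; field; rewrite gt_eqF.
pose Pmax := 2 * B + (M + B + S / A) + (M + B + S / A).
have Pmax0 : 0 < Pmax by have := divr_gt0 hS hA; rewrite /Pmax; lra.
(* the factor 4 p of the isoperimetric deficit, for all triangles at once *)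
pose C := 4 * (Pmax / (6 * k)).
have k60 : 0 < 6 * k by rewrite mulr_gt0.
have C0 : 0 < C by rewrite mulr_gt0 ?divr_gt0.
pose m := 2 * k / (2 * (Num.sqrt 3 * k ^+ 2)).
have m0 : 0 < m by rewrite divr_gt0 ?mulr_gt0 ?exprn_gt0.
pose K := 72 * tri_radius (- k, 0) (k, 0) (0, Num.sqrt 3 * k) ^+ 2.
have K0 : 0 < K.
  rewrite mulr_gt0// exprn_gt0// /tri_radius /=.
  by rewrite !ltr_wpDr// ?addr_ge0// normrN normr_gt0 gt_eqF.
have CmK : 0 < 4 * C * m * K.
  by apply: mulr_gt0 => //; apply: mulr_gt0 => //; exact: mulr_gt0.
(* the smallness condition of rayleigh_gap *)
exists (- (3 / (4 * C * m * K))); split; first by rewrite oppr_lt0 divr_gt0.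
move=> alpha a c alphac alpha0 aM Ac cB ac.
have c0 : 0 < c by exact: lt_le_trans Ac.
pose y := S / c; have y0 : 0 < y by rewrite divr_gt0.
have cy : c * y = Num.sqrt 3 * k ^+ 2 by rewrite -SE /y; field; rewrite gt_eqF.
have y_le : y <= S / A by rewrite ler_pM2l// lef_pV2.
have -> : lambda1 S alpha 0 k =
    triangle_robin_eigenvalue alpha (- k, 0) (k, 0) (0, Num.sqrt 3 * k).
  by rewrite /lambda1; congr (triangle_robin_eigenvalue _ _ _ (_, _)); rewrite {1}SE; field; rewrite gt_eqF.
set P := perimeter (- c, 0) (c, 0) (a, y).
set l1 := eucl_dist (- c, 0) (c, 0).
set l2 := eucl_dist (c, 0) (a, y).
set l3 := eucl_dist (a, y) (- c, 0).
have sq (p q : R * R) : eucl_dist p q ^+ 2 = (q.1 - p.1) ^+ 2 + (q.2 - p.2) ^+ 2.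
  by rewrite sqr_sqrtr// addr_ge0// sqr_ge0.
have l1sq : l1 ^+ 2 = 4 * c ^+ 2 by rewrite sq /=; ring.
have l2sq : l2 ^+ 2 = (a - c) ^+ 2 + y ^+ 2 by rewrite sq /=; ring.
have l3sq : l3 ^+ 2 = (a + c) ^+ 2 + y ^+ 2 by rewrite sq /=; ring.
have heron0 : 3 * (2 * k) ^+ 4 = 16 * S ^+ 2 by rewrite SE !exprMn s32; ring.
have heron : (l1 + l2 + l3) * ((l2 + l3 - l1) * (l3 + l1 - l2) * (l1 + l2 - l3)) = 16 * S ^+ 2.
  transitivity (2 * (l1 ^+ 2 * l2 ^+ 2 + l2 ^+ 2 * l3 ^+ 2 + l3 ^+ 2 * l1 ^+ 2) -
    ((l1 ^+ 2) ^+ 2 + (l2 ^+ 2) ^+ 2 + (l3 ^+ 2) ^+ 2)); first by ring.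
  have -> : S = c * y by rewrite cy.
  by rewrite l1sq l2sq l3sq; ring.
have k20 : 0 < 2 * k by rewrite mulr_gt0.
have l10 : 0 <= l1 by exact: eucl_dist_ge0.
have l20 : 0 <= l2 by exact: eucl_dist_ge0.
have l30 : 0 <= l3 by exact: eucl_dist_ge0.
have [P0le deficit] := isoperimetric_deficit hS k20 l10 l20 l30 heron0 heron.
have PE : P = l1 + l2 + l3 by [].
rewrite -PE in P0le deficit.
have sumsq : l1 ^+ 2 + l2 ^+ 2 + l3 ^+ 2 = 2 * (3 * c ^+ 2 + a ^+ 2 + y ^+ 2).
  by rewrite l1sq l2sq l3sq; ring.
have Pgt : 6 * k < P.
  rewrite lt_neqAle; apply/andP; split; last by lra.
  apply/eqP => P6; apply: ac.
  have /(isoperimetric_equality hS k20 l10 l20 l30 heron0 heron) : l1 + l2 + l3 = 3 * (2 * k).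
    by rewrite -PE -P6; ring.
  rewrite sumsq => h.
  (* with c y = sqrt 3 k^2, equality of the sums of squared sides is
     a^2 c^2 + 3 (c^2 - k^2)^2 = 0 *)
  have h0 : (c * c - k * k) ^+ 2 * 3 + a ^+ 2 * c ^+ 2 = 0.
    have -> : (c * c - k * k) ^+ 2 * 3 + a ^+ 2 * c ^+ 2 =
      c ^+ 2 * (3 * c ^+ 2 + a ^+ 2 + y ^+ 2) - 6 * k ^+ 2 * c ^+ 2 + (3 * k ^+ 4 - (c * y) ^+ 2) by ring.
    have -> : 3 * c ^+ 2 + a ^+ 2 + y ^+ 2 = 6 * k ^+ 2 by lra.
    by rewrite cy exprMn s32; ring.
  have n1 : 0 <= (c * c - k * k) ^+ 2 by exact: sqr_ge0.
  have n2 : 0 <= a ^+ 2 * c ^+ 2 by rewrite mulr_ge0 ?sqr_ge0.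
  have : a ^+ 2 * c ^+ 2 = 0 by lra.
  move/eqP; rewrite mulf_eq0 !sqrf_eq0 (gt_eqF c0) orbF => /eqP ->.
  have : (c * c - k * k) ^+ 2 = 0 by lra.
  move/eqP; rewrite sqrf_eq0 (_ : c * c - k * k = (c - k) * (c + k)); last by ring.
  by rewrite mulf_eq0 (gt_eqF (addr_gt0 c0 k0)) orbF subr_eq0 => /eqP ->.
have Ple : P <= Pmax.
  have dist_le (u v w : R) : 0 <= w -> w ^+ 2 = u ^+ 2 + v ^+ 2 -> w <= `|u| + `|v|.
    move=> w0 we; have uv0 : 0 <= `|u| + `|v| by rewrite addr_ge0.
    rewrite -(@ler_pXn2r _ 2)// ?nnegrE// we sqrrD !real_normK ?num_real//.
    by rewrite addrAC lerDl mulrn_wge0// mulr_ge0.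
  have d2 := dist_le _ _ _ l20 l2sq; have d3 := dist_le _ _ _ l30 l3sq.
  have d1 : l1 = 2 * c.
    apply/eqP; rewrite -(@eqrXn2 _ 2)//; last by rewrite mulr_ge0// ltW.
    by rewrite l1sq; apply/eqP; ring.
  have := ler_normD a c; have := ler_normB a c.
  rewrite (gtr0_norm c0) => q1 q2; rewrite (gtr0_norm y0) in d2 d3.
  by rewrite PE d1 /Pmax; lra.
apply: (@robin_lt_equilateral R k a c y alpha C) => //.
- exact: ltW.
- by rewrite -/P ltr_pdivlMr ?mulr_gt0// mul1r.
- rewrite -/P /energy_ratio /C.
  have e1 : (3 * c ^+ 2 + a ^+ 2 + y ^+ 2) / (6 * k ^+ 2) - 1 =
    3 * (l1 ^+ 2 + l2 ^+ 2 + l3 ^+ 2 - 3 * (2 * k) ^+ 2) / (6 * k) ^+ 2.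
    by rewrite sumsq; field; rewrite gt_eqF.
  rewrite e1; apply: (@le_trans _ _ (4 * P * (P - 3 * (2 * k)) / (6 * k) ^+ 2)).
    by rewrite ler_pM2r ?invr_gt0 ?exprn_gt0.
  have -> : 4 * P * (P - 3 * (2 * k)) / (6 * k) ^+ 2 = 4 * (P / (6 * k)) * (P / (6 * k) - 1).
    by field; rewrite gt_eqF.
  apply: ler_wpM2r; first by rewrite subr_ge0 ler_pdivlMr// mul1r ltW.
  by rewrite ler_pM2l// ler_pM2r ?invr_gt0.
- rewrite -/m -/K mulrC -ler_pdivlMr//; lra.
Qed.
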